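(* Consider the system of hydrodynamic type $$a_t=b_x,\qquad b_t=c_x,\qquad c_t=(b^2-ac)_x$$ on an open set of the hodograph space with coordinates $(a,b,c)$ where its characteristic velocities, i.e. the roots $v^1,v^2,v^3$ of $\lambda^3+a\lambda^2-2b\lambda+c=0$, are real and pairwise distinct. Let $$\omega^i=\left((v^i)^2+a v^i-2b\right)da+(v^i+a)\,db+dc,\qquad i=1,2,3,$$ be the corresponding left eigenforms, so that the three two-dimensional characteristic distributions are $\omega^i=0$. Let $M$ be a smooth surface in this open set on which the restrictions of $\omega^1,\omega^2,\omega^3$ are pairwise linearly independent at every point. Then $M$ is a hydrodynamic surface of the system if and only if the characteristic 3-web on $M$, formed by the three families of curves $\omega^1=0$, $\omega^2=0$, $\omega^3=0$ cut on $M$ by the characteristic distributions, is hexagonal.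
   Context: All objects are smooth and all considerations are local. The system is the equation of associativity $f_{ttt}=f_{xxt}^2-f_{xxx}f_{xtt}$ written in the variables $a=f_{xxx}$, $b=f_{xxt}$, $c=f_{xtt}$. Writing it as $u_t=V(u)u_x$ with $u=(a,b,c)^T$, the forms $\omega^i$ have as coefficients the left eigenvectors of $V$ with eigenvalues $v^i$, and the system is equivalent to $\omega^i\wedge(dx+v^i dt)=0$, $i=1,2,3$. A hydrodynamic surface is a solution of the system viewed as a non-parametrized surface in the hodograph space. That is, it is a surface $M$ such that near each point of $M$ there are local coordinates $(x,t)$ on $M$ for which the embedding $(a,b,c)=(a(x,t),b(x,t),c(x,t))$ is a solution of the system. For a 3-web (three families of curves in pairwise distinct directions) on a surface, choose 1-forms $\phi^1,\phi^2$ such that the three families are given by $\phi^1=0$, $\phi^2=0$ and $\phi^1=\phi^2$. The connection form $\phi$ is the unique 1-form with $d\phi^1=\phi\wedge\phi^1$ and $d\phi^2=\phi\wedge\phi^2$. The curvature form is $C=d\phi$, which is independent of the choice of $\phi^1,\phi^2$. The web is called hexagonal if $C=0$. *)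

(* Defs.v *)
From Stdlib Require Import Reals.
From Coquelicot Require Import Coquelicot.
Open Scope R_scope.

(** A point of the hodograph space R^3 is a triple [(a, b, c)], i.e.
    [((a, b), c)]; all topology is that of Coquelicot's product uniform
    spaces. *)

(** ** Smooth functions of two real variables *)

Definition pd1 (f : R * R -> R) (q : R * R) : R :=
  Derive (fun s => f (s, snd q)) (fst q).
Definition pd2 (f : R * R -> R) (q : R * R) : R :=
  Derive (fun s => f (fst q, s)) (snd q).

(** For an open [D], [Ck2 n D f] says that all partial derivatives of [f] of
    order [<= n] exist on [D] and that those of order [n] are jointly
    continuous there.  [Derive] is total, hence the separate [ex_derive]. *)
Fixpoint Ck2 (n : nat) (D : R * R -> Prop) (f : R * R -> R) : Prop :=
  match n with
  | O => forall q, D q -> continuous f q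
  | S m =>
      (forall q, D q -> ex_derive (fun s => f (s, snd q)) (fst q) /\
                        ex_derive (fun s => f (fst q, s)) (snd q)) /\
      Ck2 m D (pd1 f) /\ Ck2 m D (pd2 f)
  end.

Definition smooth2 (D : R * R -> Prop) (f : R * R -> R) : Prop :=
  forall n, Ck2 n D f.

(** ** Embedded surfaces of R^3 *)

Definition comp_a (r : R * R -> R * R * R) (q : R * R) : R := fst (fst (r q)).
Definition comp_b (r : R * R -> R * R * R) (q : R * R) : R := snd (fst (r q)).
Definition comp_c (r : R * R -> R * R * R) (q : R * R) : R := snd (r q).

(** [local_param M D r]: the inverse of [r : D -> M] is a system of local
    coordinates on [M].  The last conjunct says that [r] maps open subsets of
    [D] onto relatively open subsets of [M]; with injectivity and smoothness it
    makes [r] a homeomorphism of [D] onto an open piece of [M]. *)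
Definition local_param (M : R * R * R -> Prop)
    (D : R * R -> Prop) (r : R * R -> R * R * R) : Prop :=
  open D /\
  (smooth2 D (comp_a r) /\ smooth2 D (comp_b r) /\ smooth2 D (comp_c r)) /\
  (forall q, D q -> forall k l : R,
     k * pd1 (comp_a r) q + l * pd2 (comp_a r) q = 0 ->
     k * pd1 (comp_b r) q + l * pd2 (comp_b r) q = 0 ->
     k * pd1 (comp_c r) q + l * pd2 (comp_c r) q = 0 ->
     k = 0 /\ l = 0) /\
  (forall q q', D q -> D q' -> r q = r q' -> q = q') /\
  (forall O : R * R -> Prop, open O -> (forall q, O q -> D q) ->
     exists W : R * R * R -> Prop, open W /\
       forall u, (M u /\ W u) <-> (exists q, O q /\ r q = u)).

Definition smooth_surface (M : R * R * R -> Prop) : Prop :=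
  forall u, M u -> exists D r,
    local_param M D r /\ exists q, D q /\ r q = u.

(** ** Differential forms in two variables and 3-webs *)

(** A 1-form [P dq_1 + Q dq_2] is the map [q |-> (P q, Q q)]; a 2-form is the
    coefficient of [dq_1 /\ dq_2]. *)
Definition form1 := R * R -> R * R.

Definition smooth_form (D : R * R -> Prop) (w : form1) : Prop :=
  smooth2 D (fun q => fst (w q)) /\ smooth2 D (fun q => snd (w q)).

Definition eval_form (w : form1) (q X : R * R) : R :=
  fst (w q) * fst X + snd (w q) * snd X.

Definition form_sub (w w' : form1) : form1 :=
  fun q => (fst (w q) - fst (w' q), snd (w q) - snd (w' q)).

Definition wedge (w w' : form1) (q : R * R) : R :=
  fst (w q) * snd (w' q) - snd (w q) * fst (w' q).

Definition ext_d (w : form1) (q : R * R) : R :=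
  pd1 (fun p => snd (w p)) q - pd2 (fun p => fst (w p)) q.

Definition lin_indep_at (w w' : form1) (q : R * R) : Prop :=
  forall k l : R,
    k * fst (w q) + l * fst (w' q) = 0 ->
    k * snd (w q) + l * snd (w' q) = 0 -> k = 0 /\ l = 0.

(** The curves [w = 0] and [w' = 0] have the same directions on [D]. *)
Definition same_curves (D : R * R -> Prop) (w w' : form1) : Prop :=
  forall q, D q -> forall X, eval_form w q X = 0 <-> eval_form w' q X = 0.

Definition adapted (D : R * R -> Prop) (w1 w2 w3 phi1 phi2 : form1) : Prop :=
  smooth_form D phi1 /\ smooth_form D phi2 /\
  same_curves D phi1 w1 /\ same_curves D phi2 w2 /\
  same_curves D (form_sub phi1 phi2) w3.

Definition connection (D : R * R -> Prop) (phi1 phi2 phi : form1) : Prop :=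
  smooth_form D phi /\
  forall q, D q ->
    ext_d phi1 q = wedge phi phi1 q /\ ext_d phi2 q = wedge phi phi2 q.

(** The 3-web [w1 = 0], [w2 = 0], [w3 = 0] on [D] has curvature zero. The
    connection form is unique once [phi1], [phi2] are chosen and the curvature
    [ext_d phi] does not depend on that choice, so an existential is used. *)
Definition hexagonal_web (D : R * R -> Prop) (w1 w2 w3 : form1) : Prop :=
  exists phi1 phi2 phi : form1,
    adapted D w1 w2 w3 phi1 phi2 /\ connection D phi1 phi2 phi /\
    forall q, D q -> ext_d phi q = 0.

(** ** The system, its eigenforms and its hydrodynamic surfaces *)

Definition char_poly (u : R * R * R) (z : R) : R :=
  let '(a, b, c) := u in z ^ 3 + a * z ^ 2 - 2 * b * z + c.

(** Coefficients of [da], [db], [dc] in the eigenform for the characteristic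
    velocity [v]. *)
Definition omega (v : R * R * R -> R) (u : R * R * R) : R * R * R :=
  let '(a, b, c) := u in (v u ^ 2 + a * v u - 2 * b, v u + a, 1).

(** Pull-back by [r] of a 1-form of R^3 : its restriction to the surface in
    the local coordinates given by [r]. *)
Definition pullback (r : R * R -> R * R * R)
    (w : R * R * R -> R * R * R) : form1 :=
  fun q =>
    let '(wa, wb, wc) := w (r q) in
    (wa * pd1 (comp_a r) q + wb * pd1 (comp_b r) q + wc * pd1 (comp_c r) q,
     wa * pd2 (comp_a r) q + wb * pd2 (comp_b r) q + wc * pd2 (comp_c r) q).

Definition restrictions_indep (M : R * R * R -> Prop)
    (w w' : R * R * R -> R * R * R) : Prop :=
  forall D r, local_param M D r ->
  forall q, D q -> lin_indep_at (pullback r w) (pullback r w') q.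

(** The variables of [r] are [(x, t)]. *)
Definition is_solution (D : R * R -> Prop) (r : R * R -> R * R * R) : Prop :=
  forall q, D q ->
    pd2 (comp_a r) q = pd1 (comp_b r) q /\
    pd2 (comp_b r) q = pd1 (comp_c r) q /\
    pd2 (comp_c r) q =
      pd1 (fun p => comp_b r p ^ 2 - comp_a r p * comp_c r p) q.

Definition hydrodynamic_surface (M : R * R * R -> Prop) : Prop :=
  forall u, M u -> exists D r,
    local_param M D r /\ (exists q, D q /\ r q = u) /\ is_solution D r.

(** The curvature is a 2-form on [M], so its vanishing near a point may be
    tested in any one system of local coordinates around that point. *)
Definition hexagonal_on (M : R * R * R -> Prop)
    (w1 w2 w3 : R * R * R -> R * R * R) : Prop :=
  forall u, M u -> exists D r,
    local_param M D r /\ (exists q, D q /\ r q = u) /\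
    hexagonal_web D (pullback r w1) (pullback r w2) (pullback r w3).

(* Main.v *)
Require Import Defs.
From Stdlib Require Import Reals.
From Coquelicot Require Import Coquelicot.
From Stdlib Require Import Lra ClassicalEpsilon.
Open Scope R_scope.

(** On a surface, [omega^i] is proportional to [X + v^i T] for some pair of
    1-forms [X], [T], unique up to a common factor, and [M] is hydrodynamic iff
    this factor can be chosen so that [X] and [T] are closed (then [X = dx],
    [T = dt]).  The computation behind the theorem is that
    [phi1 = (v2 - v3) (X + v1 T)] and [phi2 = (v1 - v3) (X + v2 T)], which are
    normalized since [phi1 - phi2 = (v2 - v1) (X + v3 T)], are closed iff [X] and
    [T] are.  Hence on a solution the connection form of [phi1, phi2] is zero.
    Conversely, if the connection form is closed, it is locally [dg]; then
    [exp (- g) phi1] and [exp (- g) phi2] are closed, hence so are the [X], [T]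
    they define, and the primitives [x], [t] of these are the required
    coordinates by the inverse function theorem. *)

(** * C^k functions of two variables *)

(** The identity behind closedness is pointwise and does not presuppose that [X] and [T] are closed.
    Write the system as [da /\ X + db /\ T = 0], [db /\ X + dc /\ T = 0],
    [dc /\ X + d(b^2 - a c) /\ T = 0]. It forces the terms of [d((v2 - v3) (X + v1 T))] in which the
    velocities are differentiated to cancel, leaving [(v2 - v3) (dX + v1 dT)]; so one identity
    serves both directions. It becomes a rational identity once [a], [b], [c] are replaced by
    Vieta's formulas in the velocities. That the three relations [omega^i /\ (X + v^i T) = 0] give
    the system back holds because, modulo the characteristic polynomial, they are the values of one
    quadratic polynomial at three distinct points. The velocities are only assumed continuous; their
    smoothness along the surface comes from the simplicity of the roots. *)

Definition is_pd1 (f : R * R -> R) (q : R * R) (l : R) : Prop :=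
  is_derive (fun s => f (s, snd q)) (fst q) l.
Definition is_pd2 (f : R * R -> R) (q : R * R) (l : R) : Prop :=
  is_derive (fun s => f (fst q, s)) (snd q) l.

Lemma is_pd1_unique f q l : is_pd1 f q l -> pd1 f q = l.
Proof. apply is_derive_unique. Qed.

Lemma is_pd2_unique f q l : is_pd2 f q l -> pd2 f q = l.
Proof. apply is_derive_unique. Qed.

Lemma locally_slice1 (P : R * R -> Prop) q :
  locally q P -> locally (fst q) (fun s => P (s, snd q)).
Proof.
  intros [e He]; exists e; intros s Hs; apply He; split; [exact Hs|].
  apply ball_center.
Qed.

Lemma locally_slice2 (P : R * R -> Prop) q :
  locally q P -> locally (snd q) (fun s => P (fst q, s)).
Proof.
  intros [e He]; exists e; intros s Hs; apply He; split; [|exact Hs].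
  apply ball_center.
Qed.

Lemma locally_open_eq (D : R * R -> Prop) (f g : R * R -> R) q :
  open D -> D q -> (forall p, D p -> f p = g p) ->
  locally q (fun p => f p = g p).
Proof. intros HD Hq H; apply filter_imp with D; [exact H|exact (HD q Hq)]. Qed.

Lemma pd1_ext_open D f g q :
  open D -> D q -> (forall p, D p -> f p = g p) -> pd1 f q = pd1 g q.
Proof.
  intros HD Hq H; apply Derive_ext_loc.
  exact (locally_slice1 (fun p => f p = g p) q (locally_open_eq D f g q HD Hq H)).
Qed.

Lemma pd2_ext_open D f g q :
  open D -> D q -> (forall p, D p -> f p = g p) -> pd2 f q = pd2 g q.
Proof.
  intros HD Hq H; apply Derive_ext_loc.
  exact (locally_slice2 (fun p => f p = g p) q (locally_open_eq D f g q HD Hq H)).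
Qed.

Lemma Ck2_ext n D : open D -> forall f g,
  (forall q, D q -> f q = g q) -> Ck2 n D f -> Ck2 n D g.
Proof.
  intros HD; induction n as [|n IH]; intros f g E; simpl.
  - intros H q Hq. apply continuous_ext_loc with f; [|auto].
    apply (locally_open_eq D); auto.
  - intros [Hd [H1 H2]]; split; [|split].
    + intros q Hq; destruct (Hd q Hq) as [h1 h2]; split.
      * apply ex_derive_ext_loc with (2 := h1).
        exact (locally_slice1 (fun p => f p = g p) q (locally_open_eq D f g q HD Hq E)).
      * apply ex_derive_ext_loc with (2 := h2).
        exact (locally_slice2 (fun p => f p = g p) q (locally_open_eq D f g q HD Hq E)).
    + apply (IH (pd1 f)); auto. intros; apply (pd1_ext_open D); auto.
    + apply (IH (pd2 f)); auto. intros; apply (pd2_ext_open D); auto.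
Qed.

Lemma Ck2_subset n (D D' : R * R -> Prop) : (forall q, D' q -> D q) ->
  forall f, Ck2 n D f -> Ck2 n D' f.
Proof.
  intros S; induction n as [|n IH]; simpl; [auto|].
  intros f [Hd [H1 H2]]; auto.
Qed.

(** The step of every induction on the order below: the partial derivatives are supplied as explicit
    functions, to which the induction hypothesis applies. *)
Lemma Ck2_S_intro n D f f1 f2 : open D ->
  (forall q, D q -> is_pd1 f q (f1 q)) -> (forall q, D q -> is_pd2 f q (f2 q)) ->
  Ck2 n D f1 -> Ck2 n D f2 -> Ck2 (S n) D f.
Proof.
  intros HD h1 h2 H1 H2; split; [|split].
  - intros q Hq; split; [exists (f1 q); apply h1|exists (f2 q); apply h2]; auto.
  - apply Ck2_ext with f1; auto. intros q Hq; symmetry; apply is_pd1_unique; auto.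
  - apply Ck2_ext with f2; auto. intros q Hq; symmetry; apply is_pd2_unique; auto.
Qed.

Lemma Ck2_is_pd1 n D f q : Ck2 (S n) D f -> D q -> is_pd1 f q (pd1 f q).
Proof. intros [Hd _] Hq; apply Derive_correct; apply Hd; auto. Qed.

Lemma Ck2_is_pd2 n D f q : Ck2 (S n) D f -> D q -> is_pd2 f q (pd2 f q).
Proof. intros [Hd _] Hq; apply Derive_correct; apply Hd; auto. Qed.

Lemma continuous_continuity_2d (f : R * R -> R) x y :
  continuous f (x, y) -> continuity_2d_pt (fun u v => f (u, v)) x y.
Proof.
  intros H; apply continuity_2d_pt_filterlim.
  apply filterlim_ext with f; [intros [u v]; reflexivity|exact H].
Qed.

Lemma continuity_2d_continuous (f : R * R -> R) x y :
  continuity_2d_pt (fun u v => f (u, v)) x y -> continuous f (x, y).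
Proof.
  intros H; apply continuity_2d_pt_filterlim in H.
  apply filterlim_ext with (2 := H); intros [u v]; reflexivity.
Qed.

(** Total differentiability needs continuity of only one partial derivative: the increment in the
    first variable is controlled uniformly near the point, that in the second by the derivative at
    the point alone. *)
Lemma C1_differentiable D f x y : open D -> D (x, y) ->
  (forall q, D q -> ex_derive (fun s => f (s, snd q)) (fst q)) ->
  ex_derive (fun s => f (x, s)) y ->
  continuous (pd1 f) (x, y) ->
  differentiable_pt_lim (fun u v => f (u, v)) x y (pd1 f (x, y)) (pd2 f (x, y)).
Proof.
  intros HD Hq h1 h2 c.
  apply filterdiff_differentiable_pt_lim.
  apply (is_derive_filterdiff (fun u v => f (u, v)) x y (fun u v => pd1 f (u, v))).
  - apply filter_imp with D; [|exact (HD _ Hq)].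
    intros u Hu. apply Derive_correct. apply (h1 u Hu).
  - apply Derive_correct; exact h2.
  - apply continuous_ext with (pd1 f); [intros [u v]; reflexivity|exact c].
Qed.

(** [Ck2] asks for continuity only at the top order. Lower down it follows because the first partial
    derivatives are continuous by induction, so [f] is differentiable. *)
Lemma Ck2_continuous n D : open D -> forall f, Ck2 n D f ->
  forall q, D q -> continuous f q.
Proof.
  intros HD; induction n as [|n IH]; simpl; [auto|].
  intros f [Hd [H1 H2]] [x y] Hq.
  apply continuity_2d_continuous, differentiable_continuity_pt.
  exists (pd1 f (x, y)), (pd2 f (x, y)).
  apply C1_differentiable with D; auto; [|apply (Hd _ Hq)].
  intros q h; apply (Hd q h).
Qed.

Lemma Ck2_pred n D : open D -> forall f, Ck2 (S n) D f -> Ck2 n D f.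
Proof.
  intros HD; induction n as [|n IH]; intros f H.
  - intros q Hq; apply Ck2_continuous with 1%nat D; auto.
  - destruct H as [Hd [H1 H2]]; split; [exact Hd|split; auto].
Qed.

Lemma Ck2_differentiable n D f q : open D -> D q -> Ck2 (S n) D f ->
  differentiable_pt_lim (fun u v => f (u, v)) (fst q) (snd q) (pd1 f q) (pd2 f q).
Proof.
  intros HD Hq [Hd [H1 H2]]; destruct q as [x y].
  apply C1_differentiable with D; auto.
  - intros p h; apply (Hd p h).
  - apply (Hd _ Hq).
  - apply Ck2_continuous with n D; auto.
Qed.

Lemma Ck2_const n D c : open D -> Ck2 n D (fun _ => c).
Proof.
  intros HD; revert c; induction n as [|n IH]; intros c.
  - intros q _; apply continuous_const.
  - apply Ck2_S_intro with (fun _ => 0) (fun _ => 0); auto;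
      intros q _; exact (is_derive_const (V := R_NormedModule) c _).
Qed.

Lemma Ck2_fst n D : open D -> Ck2 n D fst.
Proof.
  intros HD; destruct n as [|n].
  - intros q _; apply continuous_fst.
  - apply Ck2_S_intro with (fun _ => 1) (fun _ => 0); auto using Ck2_const.
    + intros q _; exact (is_derive_id (K := R_AbsRing) (fst q)).
    + intros q _; exact (is_derive_const (V := R_NormedModule) (fst q) (snd q)).
Qed.

Lemma Ck2_snd n D : open D -> Ck2 n D snd.
Proof.
  intros HD; destruct n as [|n].
  - intros q _; apply continuous_snd.
  - apply Ck2_S_intro with (fun _ => 0) (fun _ => 1); auto using Ck2_const.
    + intros q _; exact (is_derive_const (V := R_NormedModule) (snd q) (fst q)).
    + intros q _; exact (is_derive_id (K := R_AbsRing) (snd q)).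
Qed.

Lemma is_pd1_plus f g q l m :
  is_pd1 f q l -> is_pd1 g q m -> is_pd1 (fun p => f p + g p) q (l + m).
Proof. intros; apply (is_derive_plus (V := R_NormedModule)); auto. Qed.
Lemma is_pd2_plus f g q l m :
  is_pd2 f q l -> is_pd2 g q m -> is_pd2 (fun p => f p + g p) q (l + m).
Proof. intros; apply (is_derive_plus (V := R_NormedModule)); auto. Qed.
Lemma is_pd1_minus f g q l m :
  is_pd1 f q l -> is_pd1 g q m -> is_pd1 (fun p => f p - g p) q (l - m).
Proof. intros; apply (is_derive_minus (V := R_NormedModule)); auto. Qed.
Lemma is_pd2_minus f g q l m :
  is_pd2 f q l -> is_pd2 g q m -> is_pd2 (fun p => f p - g p) q (l - m).
Proof. intros; apply (is_derive_minus (V := R_NormedModule)); auto. Qed.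
Lemma is_pd1_mult f g q l m :
  is_pd1 f q l -> is_pd1 g q m -> is_pd1 (fun p => f p * g p) q (l * g q + f q * m).
Proof.
  intros Hf Hg; destruct q as [x y].
  apply (is_derive_mult (K := R_AbsRing) _ _ _ _ _ Hf Hg Rmult_comm).
Qed.
Lemma is_pd2_mult f g q l m :
  is_pd2 f q l -> is_pd2 g q m -> is_pd2 (fun p => f p * g p) q (l * g q + f q * m).
Proof.
  intros Hf Hg; destruct q as [x y].
  apply (is_derive_mult (K := R_AbsRing) _ _ _ _ _ Hf Hg Rmult_comm).
Qed.

Lemma is_pd1_comp1 (h : R -> R) f q l m :
  is_derive h (f q) l -> is_pd1 f q m -> is_pd1 (fun p => h (f p)) q (m * l).
Proof.
  intros Hh Hf; destruct q as [x y].
  apply (is_derive_comp (V := R_NormedModule) h (fun s => f (s, y)) x); auto.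
Qed.
Lemma is_pd2_comp1 (h : R -> R) f q l m :
  is_derive h (f q) l -> is_pd2 f q m -> is_pd2 (fun p => h (f p)) q (m * l).
Proof.
  intros Hh Hf; destruct q as [x y].
  apply (is_derive_comp (V := R_NormedModule) h (fun s => f (x, s)) y); auto.
Qed.

Lemma Ck2_plus n D : open D -> forall f g,
  Ck2 n D f -> Ck2 n D g -> Ck2 n D (fun q => f q + g q).
Proof.
  intros HD; induction n as [|n IH]; intros f g Hf Hg.
  - intros q Hq; apply (continuous_plus (V := R_NormedModule)); auto.
  - apply Ck2_S_intro with (fun q => pd1 f q + pd1 g q) (fun q => pd2 f q + pd2 g q); auto.
    + intros q Hq; apply is_pd1_plus; apply (Ck2_is_pd1 n D); auto.
    + intros q Hq; apply is_pd2_plus; apply (Ck2_is_pd2 n D); auto.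
    + apply IH; [apply Hf|apply Hg].
    + apply IH; [apply Hf|apply Hg].
Qed.

Lemma Ck2_mult n D : open D -> forall f g,
  Ck2 n D f -> Ck2 n D g -> Ck2 n D (fun q => f q * g q).
Proof.
  intros HD; induction n as [|n IH]; intros f g Hf Hg.
  - intros q Hq; apply (continuous_mult (K := R_AbsRing)); auto.
  - apply Ck2_S_intro with (fun q => pd1 f q * g q + f q * pd1 g q)
      (fun q => pd2 f q * g q + f q * pd2 g q); auto.
    + intros q Hq; apply is_pd1_mult; apply (Ck2_is_pd1 n D); auto.
    + intros q Hq; apply is_pd2_mult; apply (Ck2_is_pd2 n D); auto.
    + apply Ck2_plus; auto; apply IH; auto using Ck2_pred; [apply Hf|apply Hg].
    + apply Ck2_plus; auto; apply IH; auto using Ck2_pred; [apply Hf|apply Hg].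
Qed.

Lemma Ck2_opp n D f : open D -> Ck2 n D f -> Ck2 n D (fun q => - f q).
Proof.
  intros HD Hf; apply Ck2_ext with (fun q => (-1) * f q); auto.
  - intros; ring.
  - apply Ck2_mult; auto using Ck2_const.
Qed.

Lemma Ck2_minus n D f g : open D ->
  Ck2 n D f -> Ck2 n D g -> Ck2 n D (fun q => f q - g q).
Proof. intros; apply Ck2_plus; auto using Ck2_opp. Qed.

(** The derivative of [1 / f] is a polynomial in [1 / f] and the derivative of [f], so order [n] for
    [1 / f] itself yields order [n + 1]. *)
Lemma Ck2_inv n D : open D -> forall f, (forall q, D q -> f q <> 0) ->
  Ck2 n D f -> Ck2 n D (fun q => / f q).
Proof.
  intros HD; induction n as [|n IH]; intros f Hn Hf.
  - intros q Hq.
    apply (continuous_comp f Rinv); [auto|apply continuous_Rinv; auto].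
  - apply Ck2_S_intro with (fun q => pd1 f q * (- (/ f q * / f q)))
      (fun q => pd2 f q * (- (/ f q * / f q))); auto.
    + intros q Hq; apply is_pd1_comp1; [|apply (Ck2_is_pd1 n D); auto].
      replace (- (/ f q * / f q)) with (- (1) / f q ^ 2) by (field; auto).
      apply (is_derive_inv (fun x => x)); [apply (is_derive_id (K := R_AbsRing))|auto].
    + intros q Hq; apply is_pd2_comp1; [|apply (Ck2_is_pd2 n D); auto].
      replace (- (/ f q * / f q)) with (- (1) / f q ^ 2) by (field; auto).
      apply (is_derive_inv (fun x => x)); [apply (is_derive_id (K := R_AbsRing))|auto].
    + apply Ck2_mult; [auto|apply Hf|].
      apply Ck2_opp; auto; apply Ck2_mult; auto; apply IH; auto using Ck2_pred.
    + apply Ck2_mult; [auto|apply Hf|].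
      apply Ck2_opp; auto; apply Ck2_mult; auto; apply IH; auto using Ck2_pred.
Qed.

Lemma Ck2_div n D f g : open D -> (forall q, D q -> g q <> 0) ->
  Ck2 n D f -> Ck2 n D g -> Ck2 n D (fun q => f q / g q).
Proof. intros; apply Ck2_mult; auto using Ck2_inv. Qed.

Lemma Ck2_exp n D : open D -> forall f,
  Ck2 n D f -> Ck2 n D (fun q => exp (f q)).
Proof.
  intros HD; induction n as [|n IH]; intros f Hf.
  - intros q Hq.
    apply (continuous_comp f exp); [auto|apply continuous_exp; auto].
  - apply Ck2_S_intro with (fun q => pd1 f q * exp (f q))
      (fun q => pd2 f q * exp (f q)); auto.
    + intros q Hq; apply is_pd1_comp1; [apply is_derive_exp|apply (Ck2_is_pd1 n D); auto].
    + intros q Hq; apply is_pd2_comp1; [apply is_derive_exp|apply (Ck2_is_pd2 n D); auto].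
    + apply Ck2_mult; [auto|apply Hf|auto using Ck2_pred].
    + apply Ck2_mult; [auto|apply Hf|auto using Ck2_pred].
Qed.

Lemma is_pd1_comp D f (G : R * R -> R * R) q l m : open D -> D (G q) -> Ck2 1 D f ->
  is_pd1 (fun p => fst (G p)) q l -> is_pd1 (fun p => snd (G p)) q m ->
  is_pd1 (fun p => f (G p)) q (pd1 f (G q) * l + pd2 f (G q) * m).
Proof.
  intros HD Hq Hf h1 h2; destruct q as [x y].
  apply is_derive_Reals.
  eapply derivable_pt_lim_ext;
    [|apply (derivable_pt_lim_comp_2d (fun u v => f (u, v)) (fun s => fst (G (s, y))) (fun s => snd (G (s, y))))].
  - intros s; simpl. now rewrite <- surjective_pairing.
  - apply (Ck2_differentiable 0 D f (G (x, y))); auto.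
  - apply is_derive_Reals; exact h1.
  - apply is_derive_Reals; exact h2.
Qed.

Lemma is_pd2_comp D f (G : R * R -> R * R) q l m : open D -> D (G q) -> Ck2 1 D f ->
  is_pd2 (fun p => fst (G p)) q l -> is_pd2 (fun p => snd (G p)) q m ->
  is_pd2 (fun p => f (G p)) q (pd1 f (G q) * l + pd2 f (G q) * m).
Proof.
  intros HD Hq Hf h1 h2; destruct q as [x y].
  apply is_derive_Reals.
  eapply derivable_pt_lim_ext;
    [|apply (derivable_pt_lim_comp_2d (fun u v => f (u, v)) (fun s => fst (G (x, s))) (fun s => snd (G (x, s))))].
  - intros s; simpl. now rewrite <- surjective_pairing.
  - apply (Ck2_differentiable 0 D f (G (x, y))); auto.
  - apply is_derive_Reals; exact h1.
  - apply is_derive_Reals; exact h2.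
Qed.

Lemma continuous_pairing (G : R * R -> R * R) q :
  continuous (fun p => fst (G p)) q -> continuous (fun p => snd (G p)) q ->
  continuous G q.
Proof.
  intros h1 h2; apply filterlim_locally; intros e.
  generalize (proj1 (filterlim_locally _ _) h1 e).
  generalize (proj1 (filterlim_locally _ _) h2 e).
  intros k2 k1; generalize (filter_and _ _ k1 k2).
  apply filter_imp; intros p [a b]; split; auto.
Qed.

Lemma Ck2_comp n D E (G : R * R -> R * R) : open D -> open E ->
  (forall q, E q -> D (G q)) ->
  Ck2 n E (fun q => fst (G q)) -> Ck2 n E (fun q => snd (G q)) ->
  forall f, Ck2 n D f -> Ck2 n E (fun q => f (G q)).
Proof.
  intros HD HE HG; induction n as [|n IH]; intros G1 G2 f Hf.
  - intros q Hq; apply continuous_comp; [apply continuous_pairing; auto|auto].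
  - assert (H1 : Ck2 1 D f).
    { clear -Hf HD; induction n as [|n IH]; auto using Ck2_pred. }
    apply Ck2_S_intro with
      (fun q => pd1 f (G q) * pd1 (fun p => fst (G p)) q + pd2 f (G q) * pd1 (fun p => snd (G p)) q)
      (fun q => pd1 f (G q) * pd2 (fun p => fst (G p)) q + pd2 f (G q) * pd2 (fun p => snd (G p)) q);
      auto.
    + intros q Hq; apply is_pd1_comp with D; auto; apply (Ck2_is_pd1 n E); auto.
    + intros q Hq; apply is_pd2_comp with D; auto; apply (Ck2_is_pd2 n E); auto.
    + apply Ck2_plus; auto; apply Ck2_mult; auto;
        first [apply G1|apply G2|apply IH; auto using Ck2_pred; apply Hf].
    + apply Ck2_plus; auto; apply Ck2_mult; auto;
        first [apply G1|apply G2|apply IH; auto using Ck2_pred; apply Hf].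
Qed.

(** * Roots of a cubic, and closed 1-forms *)

(** Implicit differentiation: the difference quotient of [w] is that of [N] divided by [Q], and [Q]
    tends to [Q0]. Choosing [Q] separately for each [s] allows it to come from a mean value theorem.
    It serves both for roots of the cubic and for inverse maps. *)
Lemma is_derive_of_slope (w N : R -> R) x n Q0 :
  is_derive N x n -> Q0 <> 0 ->
  (forall eps : posreal, locally x (fun s =>
     exists Q, Rabs (Q - Q0) < eps /\ (w s - w x) * Q = N s - N x)) ->
  is_derive w x (n / Q0).
Proof.
  intros HN HQ Hs; apply is_derive_Reals; intros eps Heps.
  assert (C : continuity_2d_pt (fun y z => y * / z) n Q0).
  { apply continuity_2d_pt_mult; [apply continuity_2d_pt_id1|].
    apply continuity_2d_pt_inv; [apply continuity_2d_pt_id2|exact HQ]. }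
  destruct (C (mkposreal eps Heps)) as [d Hd]; simpl in Hd.
  apply is_derive_Reals in HN.
  destruct (HN d (cond_pos d)) as [d1 H1].
  (* The bound [d] serves the continuity of [y / z] at [(n, Q0)]; the bound [Rabs Q0] keeps [Q]
     nonzero. *)
  assert (HQ2 : 0 < Rmin d (Rabs Q0)).
  { apply Rmin_pos; [apply cond_pos|apply Rabs_pos_lt; exact HQ]. }
  destruct (Hs (mkposreal _ HQ2)) as [d2 H2]; simpl in H2.
  assert (Hm : 0 < Rmin d1 d2) by (apply Rmin_pos; apply cond_pos).
  exists (mkposreal _ Hm); intros h h0 hm; simpl in hm.
  destruct (H2 (x + h)) as [Q [q1 q2]].
  { change (Rabs (x + h - x) < d2). replace (x + h - x) with h by ring.
    apply Rlt_le_trans with (1 := hm); apply Rmin_r. }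
  assert (q3 : Rabs (Q - Q0) < d) by (apply Rlt_le_trans with (1 := q1); apply Rmin_l).
  assert (q4 : Q <> 0).
  { intros ->. apply Rlt_not_le with (1 := q1).
    replace (0 - Q0) with (- Q0) by ring; rewrite Rabs_Ropp; apply Rmin_r. }
  replace ((w (x + h) - w x) / h) with (((N (x + h) - N x) / h) * / Q)
    by (rewrite <- q2; field; auto).
  apply Hd; [|exact q3].
  apply H1; auto. apply Rlt_le_trans with (1 := hm); apply Rmin_l.
Qed.

(** Subtract the cubic at [x] from the cubic at [s]. The increments of the coefficients, taken at
    the fixed value [w x], form the numerator [N]; the rest is divisible by [w s - w x], and by
    continuity of [w] the quotient tends to the derivative of the cubic at [w x]. *)
Lemma cubic_root_is_derive (w a b c : R -> R) x la lb lc :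
  continuous w x -> is_derive a x la -> is_derive b x lb -> is_derive c x lc ->
  w x ^ 3 + a x * w x ^ 2 - 2 * b x * w x + c x = 0 ->
  locally x (fun s => w s ^ 3 + a s * w s ^ 2 - 2 * b s * w s + c s = 0) ->
  3 * w x ^ 2 + 2 * a x * w x - 2 * b x <> 0 ->
  is_derive w x (- (la * w x ^ 2 - 2 * lb * w x + lc) /
                 (3 * w x ^ 2 + 2 * a x * w x - 2 * b x)).
Proof.
  intros Hw Ha Hb Hc H0 Hl Hn.
  apply (is_derive_of_slope w (fun s => - (a s * w x ^ 2 - 2 * b s * w x + c s))); auto.
  - auto_derive.
    + repeat split; eexists; eassumption.
    + replace (Derive (fun s => a s) x) with la by (symmetry; apply is_derive_unique, Ha).
      replace (Derive (fun s => b s) x) with lb by (symmetry; apply is_derive_unique, Hb).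
      replace (Derive (fun s => c s) x) with lc by (symmetry; apply is_derive_unique, Hc).
      ring.
  - intros eps.
    assert (C : continuous (fun s => w s * w s + w s * w x + w x * w x + a s * (w s + w x) - 2 * b s) x).
    { assert (ca : continuous a x) by exact (ex_derive_continuous (V := R_NormedModule) a x (ex_intro _ la Ha)).
      assert (cb : continuous b x) by exact (ex_derive_continuous (V := R_NormedModule) b x (ex_intro _ lb Hb)).
      apply (continuous_minus (V := R_NormedModule)).
      - apply (continuous_plus (V := R_NormedModule)).
        + apply (continuous_plus (V := R_NormedModule)); [|apply continuous_const].
          apply (continuous_plus (V := R_NormedModule));
            apply (continuous_mult (K := R_AbsRing)); auto; apply continuous_const.
        + apply (continuous_mult (K := R_AbsRing)); auto.
          apply (continuous_plus (V := R_NormedModule)); auto; apply continuous_const.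
      - apply (continuous_mult (K := R_AbsRing)); auto; apply continuous_const. }
    generalize (proj1 (filterlim_locally _ _) C eps); intros C1.
    generalize (filter_and _ _ C1 Hl); apply filter_imp; intros s [h1 h2].
    exists (w s * w s + w s * w x + w x * w x + a s * (w s + w x) - 2 * b s); split.
    + change (Rabs (w s * w s + w s * w x + w x * w x + a s * (w s + w x) - 2 * b s -
        (w x * w x + w x * w x + w x * w x + a x * (w x + w x) - 2 * b x)) < eps) in h1.
      replace (3 * w x ^ 2 + 2 * a x * w x - 2 * b x) with
        (w x * w x + w x * w x + w x * w x + a x * (w x + w x) - 2 * b x) by ring.
      exact h1.
    + apply Rminus_diag_uniq.
      transitivity ((w s ^ 3 + a s * w s ^ 2 - 2 * b s * w s + c s) -
        (w x ^ 3 + a x * w x ^ 2 - 2 * b x * w x + c x)); [ring|].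
      rewrite h2, H0; ring.
Qed.

Lemma continuous_slice1 (f : R * R -> R) q :
  continuous f q -> continuous (fun s => f (s, snd q)) (fst q).
Proof.
  intros H; destruct q as [x y]; simpl.
  apply (continuous_comp (fun s => (s, y)) f); [|exact H].
  apply filterlim_locally; intros e; exists e; intros s Hs; split; [exact Hs|apply ball_center].
Qed.

Lemma continuous_slice2 (f : R * R -> R) q :
  continuous f q -> continuous (fun s => f (fst q, s)) (snd q).
Proof.
  intros H; destruct q as [x y]; simpl.
  apply (continuous_comp (fun s => (x, s)) f); [|exact H].
  apply filterlim_locally; intros e; exists e; intros s Hs; split; [apply ball_center|exact Hs].
Qed.

Ltac smooth_tac :=
  repeat first [assumption | apply Ck2_const | apply Ck2_plus | apply Ck2_minus
    | apply Ck2_mult | apply Ck2_opp ].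

(** Bootstrapping: the partial derivatives of [w] are rational in [w], the coefficients and their
    derivatives, so [w] of class [C^n] makes them [C^n], hence [w] of class [C^(n+1)]. *)
Lemma cubic_root_smooth D (w a b c : R * R -> R) : open D ->
  (forall q, D q -> continuous w q) ->
  smooth2 D a -> smooth2 D b -> smooth2 D c ->
  (forall q, D q -> w q ^ 3 + a q * w q ^ 2 - 2 * b q * w q + c q = 0) ->
  (forall q, D q -> 3 * w q ^ 2 + 2 * a q * w q - 2 * b q <> 0) ->
  smooth2 D w.
Proof.
  intros HD Hw Ha Hb Hc H0 Hn n.
  induction n as [|n IH]; [exact Hw|].
  assert (Hl : forall q, D q -> locally q (fun q => w q ^ 3 + a q * w q ^ 2 - 2 * b q * w q + c q = 0)).
  { intros q Hq; apply filter_imp with D; [exact H0|exact (HD q Hq)]. }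
  apply Ck2_S_intro with
    (fun q => - (pd1 a q * w q ^ 2 - 2 * pd1 b q * w q + pd1 c q) /
       (3 * w q ^ 2 + 2 * a q * w q - 2 * b q))
    (fun q => - (pd2 a q * w q ^ 2 - 2 * pd2 b q * w q + pd2 c q) /
       (3 * w q ^ 2 + 2 * a q * w q - 2 * b q)); auto.
  - intros q Hq; destruct q as [x y].
    apply (cubic_root_is_derive (fun s => w (s, y)) (fun s => a (s, y))
             (fun s => b (s, y)) (fun s => c (s, y)) x).
    + exact (continuous_slice1 w (x, y) (Hw _ Hq)).
    + apply (Ck2_is_pd1 0 D a (x, y) (Ha _) Hq).
    + apply (Ck2_is_pd1 0 D b (x, y) (Hb _) Hq).
    + apply (Ck2_is_pd1 0 D c (x, y) (Hc _) Hq).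
    + apply (H0 _ Hq).
    + exact (locally_slice1 _ _ (Hl _ Hq)).
    + apply (Hn _ Hq).
  - intros q Hq; destruct q as [x y].
    apply (cubic_root_is_derive (fun s => w (x, s)) (fun s => a (x, s))
             (fun s => b (x, s)) (fun s => c (x, s)) y).
    + exact (continuous_slice2 w (x, y) (Hw _ Hq)).
    + apply (Ck2_is_pd2 0 D a (x, y) (Ha _) Hq).
    + apply (Ck2_is_pd2 0 D b (x, y) (Hb _) Hq).
    + apply (Ck2_is_pd2 0 D c (x, y) (Hc _) Hq).
    + apply (H0 _ Hq).
    + exact (locally_slice2 _ _ (Hl _ Hq)).
    + apply (Hn _ Hq).
  - destruct (Ha (S n)) as [_ [a1 _]], (Hb (S n)) as [_ [b1 _]], (Hc (S n)) as [_ [c1 _]].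
    pose proof (Ha n); pose proof (Hb n).
    apply Ck2_div; auto; simpl; smooth_tac.
  - destruct (Ha (S n)) as [_ [_ a1]], (Hb (S n)) as [_ [_ b1]], (Hc (S n)) as [_ [_ c1]].
    pose proof (Ha n); pose proof (Hb n).
    apply Ck2_div; auto; simpl; smooth_tac.
Qed.

(** * Primitives of closed 1-forms on a square *)

Lemma ball_pair (q0 q : R * R) e :
  ball q0 e q <-> Rabs (fst q - fst q0) < e /\ Rabs (snd q - snd q0) < e.
Proof. split; intros [h1 h2]; split; assumption. Qed.

Lemma open_ball_pair (q0 : R * R) e : open (ball q0 e).
Proof.
  destruct q0 as [x0 y0]; intros [x y] Hq.
  destruct (proj1 (ball_pair _ _ _) Hq) as [h1 h2]; simpl in h1, h2.
  assert (He : 0 < Rmin (e - Rabs (x - x0)) (e - Rabs (y - y0)))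
    by (apply Rmin_pos; lra).
  exists (mkposreal _ He); intros [s t] Hp.
  destruct (proj1 (ball_pair _ _ _) Hp) as [k1 k2]; simpl in k1, k2.
  apply ball_pair; simpl.
  pose proof (Rmin_l (e - Rabs (x - x0)) (e - Rabs (y - y0))).
  pose proof (Rmin_r (e - Rabs (x - x0)) (e - Rabs (y - y0))).
  split.
  - replace (s - x0) with ((s - x) + (x - x0)) by ring.
    eapply Rle_lt_trans; [apply Rabs_triang|lra].
  - replace (t - y0) with ((t - y) + (y - y0)) by ring.
    eapply Rle_lt_trans; [apply Rabs_triang|lra].
Qed.

Lemma Rabs_between (a b e t : R) :
  Rabs (b - a) < e -> Rmin a b <= t <= Rmax a b -> Rabs (t - a) < e.
Proof.
  intros H; unfold Rmin, Rmax; destruct (Rle_dec a b); intros [h1 h2];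
    apply Rabs_def2 in H; apply Rabs_def1; lra.
Qed.

Lemma is_derive_Rplus (f g : R -> R) x l m k : is_derive f x l -> is_derive g x m ->
  l + m = k -> is_derive (fun s => f s + g s) x k.
Proof. intros Hf Hg <-; exact (is_derive_plus (V := R_NormedModule) f g x l m Hf Hg). Qed.

Lemma ex_RInt_continuous_R (f : R -> R) a b :
  (forall z, Rmin a b <= z <= Rmax a b -> continuous f z) -> ex_RInt f a b.
Proof. exact (ex_RInt_continuous (V := R_CompleteNormedModule) f a b). Qed.

Lemma is_derive_RInt_upper (f : R -> R) a b :
  locally b (fun s => forall z, Rmin a s <= z <= Rmax a s -> continuous f z) ->
  is_derive (fun s => RInt f a s) b (f b).
Proof.
  intros H; apply (is_derive_RInt (V := R_NormedModule) f (fun s => RInt f a s) a b).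
  - revert H; apply filter_imp; intros s Hs.
    exact (RInt_correct (V := R_CompleteNormedModule) f a s (ex_RInt_continuous_R f a s Hs)).
  - apply locally_singleton in H; apply H; split; [apply Rmin_r|apply Rmax_r].
Qed.

(** Integrate along a horizontal segment at the height of the centre, then along a vertical one;
    balls of the product space are squares, so this path stays inside. *)
Lemma poincare (q0 : R * R) (e : posreal) (w : Defs.form1) :
  smooth_form (ball q0 e) w -> (forall q, ball q0 e q -> ext_d w q = 0) ->
  exists g, smooth2 (ball q0 e) g /\
    forall q, ball q0 e q -> is_pd1 g q (fst (w q)) /\ is_pd2 g q (snd (w q)).
Proof.
  intros [HP HQ] Hw.
  set (P := fun q => fst (w q)) in *; set (Q := fun q => snd (w q)) in *.
  destruct q0 as [p0 r0]; set (B := ball (p0, r0) e) in *.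
  assert (HB : open B) by apply open_ball_pair.
  assert (HBp : forall x y, B (x, y) <-> Rabs (x - p0) < e /\ Rabs (y - r0) < e)
    by (intros; apply ball_pair).
  assert (z0 : Rabs (r0 - r0) < e)
    by (rewrite Rminus_diag, Rabs_R0; apply cond_pos).
  assert (z1 : Rabs (p0 - p0) < e)
    by (rewrite Rminus_diag, Rabs_R0; apply cond_pos).
  assert (cP : forall x y, B (x, y) -> continuous (fun s => P (s, y)) x).
  { intros x y H; apply (continuous_slice1 P (x, y)), (HP 0%nat); exact H. }
  assert (cQ : forall x y, B (x, y) -> continuous (fun s => Q (x, s)) y).
  { intros x y H; apply (continuous_slice2 Q (x, y)), (HQ 0%nat); exact H. }
  set (g := fun q : R * R => RInt (fun s => P (s, r0)) p0 (fst q) +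
                             RInt (fun s => Q (fst q, s)) r0 (snd q)).
  assert (g2 : forall q, B q -> is_pd2 g q (Q q)).
  { intros [x y] Hq. pose proof (proj1 (HBp x y) Hq) as [hx hy].
    unfold is_pd2, g; simpl.
    apply is_derive_Rplus with 0 (Q (x, y)); [| |apply Rplus_0_l].
    - exact (is_derive_const (V := R_NormedModule) _ y).
    - apply (is_derive_RInt_upper (fun s => Q (x, s))).
      apply filter_imp with (fun s => B (x, s)).
      + intros s Hs z Hz; pose proof (proj1 (HBp x s) Hs) as [_ hs].
        apply cQ, HBp; split; [exact hx|].
        apply Rabs_between with (2 := Hz); exact hs.
      + exact (locally_slice2 B (x, y) (HB _ Hq)). }
  assert (g1 : forall q, B q -> is_pd1 g q (P q)).
  { intros [x y] Hq. pose proof (proj1 (HBp x y) Hq) as [hx hy].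
    assert (hQ1 : is_derive (fun x => RInt (fun s => Q (x, s)) r0 y) x
              (RInt (fun s => pd1 Q (x, s)) r0 y)).
    { apply (is_derive_RInt_param (fun x s => Q (x, s)) r0 y x).
      - apply filter_imp with (fun s => B (s, y)).
        + intros s Hs t Ht; pose proof (proj1 (HBp s y) Hs) as [hs _].
          apply (proj1 (HQ 1%nat) (s, t)). apply HBp; split; [exact hs|].
          apply Rabs_between with (2 := Ht); exact hy.
        + exact (locally_slice1 B (x, y) (HB _ Hq)).
      - intros t Ht; apply (continuous_continuity_2d (pd1 Q)).
        apply (proj1 (proj2 (HQ 1%nat))); apply HBp; split; [exact hx|].
        apply Rabs_between with (2 := Ht); exact hy.
      - apply filter_imp with (fun s => B (s, y)).
        + intros s Hs; pose proof (proj1 (HBp s y) Hs) as [hs _].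
          apply ex_RInt_continuous_R.
          intros z Hz; apply cQ, HBp; split; [exact hs|].
          apply Rabs_between with (2 := Hz); exact hy.
        + exact (locally_slice1 B (x, y) (HB _ Hq)). }
    assert (Hl : forall t, Rmin r0 y <= t <= Rmax r0 y -> B (x, t)).
    { intros t Ht; apply HBp; split; [exact hx|].
      apply Rabs_between with (2 := Ht); exact hy. }
    (* Closedness enters here: it turns the integrand into [pd2 P], and the value [P (x, r0)]
       cancels against the derivative of the horizontal integral. *)
    assert (E : RInt (fun s => pd1 Q (x, s)) r0 y = P (x, y) - P (x, r0)).
    { apply is_RInt_unique.
      apply (is_RInt_ext (fun s => pd2 P (x, s))).
      - intros s Hs. specialize (Hw (x, s)).
        unfold ext_d in Hw; fold P in Hw; fold Q in Hw.
        symmetry; apply Rminus_diag_uniq; apply Hw, Hl; lra.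
      - apply (is_RInt_derive (fun s => P (x, s)) (fun s => pd2 P (x, s))).
        + intros t Ht; apply (Ck2_is_pd2 0 B P (x, t) (HP _) (Hl t Ht)).
        + intros t Ht; apply (continuous_slice2 (pd2 P) (x, t)).
          apply (proj2 (proj2 (HP 1%nat))); apply Hl, Ht. }
    unfold is_pd1, g; simpl.
    apply is_derive_Rplus with (2 := hQ1) (l := P (x, r0)); [|rewrite E; apply Rplus_minus].
    apply (is_derive_RInt_upper (fun s => P (s, r0))).
    apply filter_imp with (fun s => B (s, y)).
    + intros s Hs z Hz; pose proof (proj1 (HBp s y) Hs) as [hs _].
      apply cP, HBp; split; [|exact z0].
      apply Rabs_between with (2 := Hz); exact hs.
    + exact (locally_slice1 B (x, y) (HB _ Hq)). }
  exists g; split; [|intros q Hq; split; [apply g1|apply g2]; exact Hq].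
  assert (HS : forall n, Ck2 (S n) B g).
  { intros n; apply Ck2_S_intro with P Q; auto. }
  intros n; apply Ck2_pred; auto.
Qed.

(** * The inverse function theorem in the plane *)

(** [F] and [G] are total functions, so the inverse relations and smoothness are required on [D] and
    [E] only; their values elsewhere are arbitrary. *)
Record diffeo (D E : R * R -> Prop) (F G : R * R -> R * R) : Prop := {
  diffeo_open_dom : open D;
  diffeo_open_cod : open E;
  diffeo_cod : forall q, D q -> E (F q);
  diffeo_dom : forall e, E e -> D (G e);
  diffeo_GF : forall q, D q -> G (F q) = q;
  diffeo_FG : forall e, E e -> F (G e) = e;
  diffeo_F1 : smooth2 D (fun q => fst (F q));
  diffeo_F2 : smooth2 D (fun q => snd (F q));
  diffeo_G1 : smooth2 E (fun e => fst (G e));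
  diffeo_G2 : smooth2 E (fun e => snd (G e)) }.

Lemma continuous_fst_pair (q : R * R) : continuous (fun p : R * R => fst p) q.
Proof. destruct q as [x y]; exact (continuous_fst x y). Qed.

Lemma continuous_snd_pair (q : R * R) : continuous (fun p : R * R => snd p) q.
Proof. destruct q as [x y]; exact (continuous_snd x y). Qed.

Lemma open_preimage D E (F : R * R -> R * R) : open D -> open E ->
  (forall q, D q -> continuous F q) -> open (fun q => D q /\ E (F q)).
Proof.
  intros HD HE HF q [h1 h2].
  apply filter_and; [exact (HD q h1)|].
  apply (HF q h1 E), HE, h2.
Qed.

Lemma smooth2_continuous_pair D (F : R * R -> R * R) q : D q ->
  smooth2 D (fun q => fst (F q)) -> smooth2 D (fun q => snd (F q)) -> continuous F q.
Proof.
  intros Hq h1 h2; apply continuous_pairing; [apply (h1 0%nat)|apply (h2 0%nat)]; auto.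
Qed.

Lemma smooth2_comp D E (G : R * R -> R * R) f : open D -> open E ->
  (forall q, E q -> D (G q)) ->
  smooth2 E (fun q => fst (G q)) -> smooth2 E (fun q => snd (G q)) ->
  smooth2 D f -> smooth2 E (fun q => f (G q)).
Proof. intros HD HE HG h1 h2 hf n; apply Ck2_comp with D; auto. Qed.

Lemma diffeo_comp D E E' F G F' G' :
  diffeo D E F G -> diffeo E E' F' G' ->
  diffeo D E' (fun q => F' (F q)) (fun e => G (G' e)).
Proof.
  intros [d1 d2 d3 d4 d5 d6 d7 d8 d9 d10] [e1 e2 e3 e4 e5 e6 e7 e8 e9 e10].
  constructor; auto.
  - intros q Hq; rewrite e5; auto.
  - intros e He; rewrite d6; auto.
  - apply (smooth2_comp E D F (fun q => fst (F' q))); auto.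
  - apply (smooth2_comp E D F (fun q => snd (F' q))); auto.
  - apply (smooth2_comp E E' G' (fun q => fst (G q))); auto.
  - apply (smooth2_comp E E' G' (fun q => snd (G q))); auto.
Qed.

Lemma diffeo_restrict D E F G E' : open E' -> (forall e, E' e -> E e) ->
  diffeo D E F G -> diffeo (fun q => D q /\ E' (F q)) E' F G.
Proof.
  intros HE' S [d1 d2 d3 d4 d5 d6 d7 d8 d9 d10]; constructor; auto.
  - apply open_preimage; auto.
    intros q Hq; apply smooth2_continuous_pair with D; auto.
  - intros q [_ H]; exact H.
  - intros e He; rewrite d6; auto.
  - intros q [H _]; auto.
  - intros n; apply Ck2_subset with D; [intros q [H _]; exact H|apply d7].
  - intros n; apply Ck2_subset with D; [intros q [H _]; exact H|apply d8].
  - intros n; apply Ck2_subset with E; auto.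
  - intros n; apply Ck2_subset with E; auto.
Qed.

Lemma diffeo_ext D E F G F' : (forall q, D q -> F q = F' q) ->
  diffeo D E F G -> diffeo D E F' G.
Proof.
  intros S [d1 d2 d3 d4 d5 d6 d7 d8 d9 d10]; constructor; auto.
  - intros q Hq; rewrite <- S; auto.
  - intros q Hq; rewrite <- S; auto.
  - intros e He; rewrite <- S; auto.
  - intros n; apply Ck2_ext with (fun q => fst (F q)); auto.
    intros q Hq; rewrite S; auto.
  - intros n; apply Ck2_ext with (fun q => snd (F q)); auto.
    intros q Hq; rewrite S; auto.
Qed.

Definition swap (q : R * R) : R * R := (snd q, fst q).

Lemma swap_swap q : swap (swap q) = q.
Proof. destruct q; reflexivity. Qed.

Lemma diffeo_swap D : open D -> diffeo (fun q => D (swap q)) D swap swap.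
Proof.
  intros HD.
  assert (open (fun q => D (swap q))).
  { refine (open_comp swap D _ HD).
    intros q _; apply continuous_pairing;
      [exact (continuous_snd_pair q)|exact (continuous_fst_pair q)]. }
  constructor; auto; try (intros n; first [apply Ck2_fst|apply Ck2_snd]; assumption).
  - intros e He; rewrite swap_swap; exact He.
  - intros q _; apply swap_swap.
  - intros q _; apply swap_swap.
Qed.

Lemma mvt_slice1 (D : R * R -> Prop) (f : R * R -> R) (x x' y : R) : (forall t, Rmin x x' <= t <= Rmax x x' -> D (t, y)) ->
  smooth2 D f -> exists t, Rmin x x' <= t <= Rmax x x' /\
    f (x', y) - f (x, y) = pd1 f (t, y) * (x' - x).
Proof.
  intros HD Hf.
  assert (d : forall t, Rmin x x' <= t <= Rmax x x' ->
    is_derive (fun s => f (s, y)) t (pd1 f (t, y))).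
  { intros t Ht; exact (Ck2_is_pd1 0 D f (t, y) (Hf _) (HD t Ht)). }
  apply (MVT_gen (fun s => f (s, y)) x x' (fun t => pd1 f (t, y))).
  - intros t Ht; apply d; lra.
  - intros t Ht; apply derivable_continuous_pt. exists (pd1 f (t, y)).
    apply is_derive_Reals, d, Ht.
Qed.

Lemma open_interval (x0 : R) e : open (fun x : R => Rabs (x - x0) < e).
Proof.
  intros x Hx. assert (He : 0 < e - Rabs (x - x0)) by lra.
  exists (mkposreal _ He); intros t Ht.
  change (Rabs (t - x) < e - Rabs (x - x0)) in Ht.
  replace (t - x0) with ((t - x) + (x - x0)) by ring.
  eapply Rle_lt_trans; [apply Rabs_triang|lra].
Qed.

Lemma open_fst_interval (x0 : R) e : open (fun q : R * R => Rabs (fst q - x0) < e).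
Proof.
  refine (open_comp (fun q : R * R => fst q) _ _ (open_interval x0 e)).
  intros q _; exact (continuous_fst_pair q).
Qed.

Lemma open_snd_interval (x0 : R) e : open (fun q : R * R => Rabs (snd q - x0) < e).
Proof.
  refine (open_comp (fun q : R * R => snd q) _ _ (open_interval x0 e)).
  intros q _; exact (continuous_snd_pair q).
Qed.

(** The inverse function theorem in one variable, with [y] as parameter. Monotonicity in the first
    variable gives existence by the intermediate value theorem; the lower bound on the slope gives
    uniqueness and continuity; the mean value theorem gives the derivatives of the inverse, and
    bootstrapping its smoothness. *)
Lemma shear_inverse (D : R * R -> Prop) (f : R * R -> R) (q0 : R * R) : open D -> D q0 -> smooth2 D f -> pd1 f q0 <> 0 ->
  exists D' E G, D' q0 /\ (forall q, D' q -> D q) /\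
    diffeo D' E (fun q => (f q, snd q)) G.
Proof.
  intros HD Hq0 Hf Hn. destruct q0 as [x0 y0]. set (s0 := f (x0, y0)).
  assert (cf : forall q, D q -> continuous f q) by exact (Hf 0%nat).
  assert (cf1 : forall q, D q -> continuous (pd1 f) q) by (apply (Hf 1%nat)).
  (* With [sg] the sign of [pd1 f q0], [sg * f] is increasing in its first
     argument near [q0], with slope at least [m]. *)
  assert (Hsg : exists sg, sg * sg = 1 /\ sg * pd1 f (x0, y0) = Rabs (pd1 f (x0, y0))).
  { destruct (Rle_dec 0 (pd1 f (x0, y0))).
    - exists 1; rewrite Rabs_pos_eq by auto; split; ring.
    - exists (-1); rewrite Rabs_left by lra; split; ring. }
  destruct Hsg as [sg [sg2 sgp]].
  (* Half of the slope at [q0]: near [q0] the slope varies by less than [m], hence stays above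
     [2 m - m]. *)
  set (m := Rabs (pd1 f (x0, y0)) / 2).
  assert (Hm : 0 < m) by (unfold m; pose proof (Rabs_pos_lt _ Hn); lra).
  assert (HR : exists rho : posreal, forall x y, Rabs (x - x0) <= rho -> Rabs (y - y0) <= rho ->
     D (x, y) /\ m < sg * pd1 f (x, y)).
  { assert (L : locally (x0, y0) (fun q => D q /\ Rabs (pd1 f q - pd1 f (x0, y0)) < m)).
    { apply filter_and; [exact (HD _ Hq0)|].
      exact (proj1 (filterlim_locally _ _) (cf1 _ Hq0) (mkposreal m Hm)). }
    destruct L as [r Hr].
    assert (r2 : 0 < r / 2) by (pose proof (cond_pos r); lra).
    exists (mkposreal _ r2); simpl; intros x y hx hy.
    destruct (Hr (x, y)) as [k1 k2].
    { apply ball_pair; simpl; split; lra. }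
    split; [exact k1|].
    assert (Rabs (sg * (pd1 f (x, y) - pd1 f (x0, y0))) < m).
    { rewrite Rabs_mult. replace (Rabs sg) with 1; [lra|].
      assert (sg = 1 \/ sg = -1) as [-> | ->].
      { assert ((sg - 1) * (sg + 1) = 0) as z by lra.
        apply Rmult_integral in z; lra. }
      - rewrite Rabs_R1; reflexivity.
      - rewrite Rabs_left; lra. }
    apply Rabs_def2 in H. replace (sg * (pd1 f (x, y) - pd1 f (x0, y0)))
      with (sg * pd1 f (x, y) - 2 * m) in H by (unfold m; rewrite <- sgp; field).
    lra. }
  destruct HR as [rho HR].
  assert (Hrho := cond_pos rho).
  assert (mono : forall x x' y, Rabs (x - x0) <= rho -> Rabs (x' - x0) <= rho ->
    Rabs (y - y0) <= rho -> x <= x' -> m * (x' - x) <= sg * (f (x', y) - f (x, y))).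
  { intros x x' y hx hx' hy hle.
    destruct (mvt_slice1 (fun q => Rabs (fst q - x0) <= rho /\ Rabs (snd q - y0) <= rho) f x x' y)
      as [t [ht1 ht2]].
    - intros t Ht; simpl; split; [|exact hy].
      rewrite Rmin_left, Rmax_right in Ht by auto.
      apply Rabs_le; apply Rabs_le_between in hx, hx'; lra.
    - intros n; apply Ck2_subset with D; [|apply Hf].
      intros [x1 y1] [k1 k2]; apply HR; auto.
    - rewrite ht2, <- Rmult_assoc. apply Rmult_le_compat_r; [lra|].
      rewrite Rmin_left, Rmax_right in ht1 by auto.
      apply Rlt_le, HR; [|exact hy].
      apply Rabs_le; apply Rabs_le_between in hx, hx'; lra. }
  assert (lip : forall x x' y, Rabs (x - x0) <= rho -> Rabs (x' - x0) <= rho ->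
    Rabs (y - y0) <= rho -> m * Rabs (x' - x) <= Rabs (f (x', y) - f (x, y))).
  { assert (asg : forall z, Rabs (sg * z) = Rabs z).
    { intros z; rewrite Rabs_mult; replace (Rabs sg) with 1; [ring|].
      rewrite <- (Rabs_pos_eq 1), <- sg2, Rabs_mult by lra.
      assert (Rabs sg * Rabs sg = 1) by (rewrite <- Rabs_mult, sg2; apply Rabs_R1).
      assert (0 <= Rabs sg) by apply Rabs_pos. nra. }
    assert (lip1 : forall x x' y, Rabs (x - x0) <= rho -> Rabs (x' - x0) <= rho ->
      Rabs (y - y0) <= rho -> x <= x' -> m * Rabs (x' - x) <= Rabs (f (x', y) - f (x, y))).
    { intros x x' y hx hx' hy hle.
      rewrite (Rabs_pos_eq (x' - x)) by lra.
      apply Rle_trans with (1 := mono x x' y hx hx' hy hle).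
      rewrite <- (asg (f (x', y) - f (x, y))); apply Rle_abs. }
    intros x x' y hx hx' hy. destruct (Rle_dec x x') as [h|h]; [auto|].
    rewrite (Rabs_minus_sym x'), (Rabs_minus_sym (f (x', y))); apply lip1; auto; lra. }
  assert (ax0 : Rabs (x0 - x0) <= rho) by (rewrite Rminus_diag, Rabs_R0; lra).
  assert (ay0 : Rabs (y0 - y0) <= rho) by (rewrite Rminus_diag, Rabs_R0; lra).
  assert (axp : Rabs (x0 + rho - x0) <= rho)
    by (replace (x0 + rho - x0) with (pos rho) by ring; rewrite Rabs_pos_eq; lra).
  assert (axm : Rabs (x0 - rho - x0) <= rho)
    by (replace (x0 - rho - x0) with (- pos rho) by ring; rewrite Rabs_Ropp, Rabs_pos_eq; lra).
  (* At height [y0], [f] moves by at least [m * rho = 2 * eta] from [x0] to [x0 + rho] or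
     [x0 - rho]. Changing the height costs less than [eta], and the target [s] lies within [eta] of
     [s0], so the signs at the two ends survive. *)
  set (eta := m * rho / 2).
  assert (Heta : 0 < eta) by (unfold eta; apply Rdiv_lt_0_compat; [apply Rmult_lt_0_compat; lra|lra]).
  assert (HE : exists delta : posreal, delta <= rho /\ forall y, Rabs (y - y0) < delta ->
     Rabs (f (x0 + rho, y) - f (x0 + rho, y0)) < eta /\
     Rabs (f (x0 - rho, y) - f (x0 - rho, y0)) < eta).
  { assert (L : locally y0 (fun y => Rabs (f (x0 + rho, y) - f (x0 + rho, y0)) < eta /\
     Rabs (f (x0 - rho, y) - f (x0 - rho, y0)) < eta)).
    { apply filter_and.
      - apply (proj1 (filterlim_locally _ _) (continuous_slice2 f (x0 + rho, y0) (cf _ (proj1 (HR _ _ axp ay0)))) (mkposreal eta Heta)).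
      - apply (proj1 (filterlim_locally _ _) (continuous_slice2 f (x0 - rho, y0) (cf _ (proj1 (HR _ _ axm ay0)))) (mkposreal eta Heta)). }
    destruct L as [d Hd].
    assert (H : 0 < Rmin d rho) by (apply Rmin_pos; apply cond_pos).
    exists (mkposreal _ H); simpl; split; [apply Rmin_r|].
    intros y Hy; apply Hd. apply Rlt_le_trans with (1 := Hy); apply Rmin_l. }
  destruct HE as [delta [Hdr HE]].
  set (E := fun e : R * R => Rabs (fst e - s0) < eta /\ Rabs (snd e - y0) < delta).
  assert (solv : forall e, E e -> exists x, Rabs (x - x0) < rho /\ f (x, snd e) = fst e).
  { intros [s y] [h1 h2]; simpl in h1, h2 |- *.
    assert (hy : Rabs (y - y0) <= rho) by lra.
    destruct (HE y h2) as [k1 k2].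
    pose proof (mono x0 (x0 + rho) y0 ax0 axp ay0 ltac:(lra)) as m1.
    pose proof (mono (x0 - rho) x0 y0 axm ax0 ay0 ltac:(lra)) as m2.
    fold s0 in m1, m2.
    assert (sgc : sg = 1 \/ sg = -1).
    { assert ((sg - 1) * (sg + 1) = 0) as z by lra.
      apply Rmult_integral in z; lra. }
    replace (m * (x0 + rho - x0)) with (2 * eta) in m1 by (unfold eta; field).
    replace (m * (x0 - (x0 - rho))) with (2 * eta) in m2 by (unfold eta; field).
    apply Rabs_def2 in h1, k1, k2.
    assert (p1 : 0 < sg * (f (x0 + rho, y) - s)) by (destruct sgc; subst sg; lra).
    assert (p2 : sg * (f (x0 - rho, y) - s) < 0) by (destruct sgc; subst sg; lra).
    destruct (Ranalysis5.IVT_interv (fun x => sg * (f (x, y) - s)) (x0 - rho) (x0 + rho)) as [z [z1 z2]]; auto.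
    - intros t Ht. apply continuity_pt_mult; [apply continuity_pt_const; intros ? ?; reflexivity|].
      apply continuity_pt_minus; [|apply continuity_pt_const; intros ? ?; reflexivity].
      apply continuity_pt_filterlim.
      apply (continuous_slice1 f (t, y)), cf, HR; [|exact hy].
      apply Rabs_le; lra.
    - lra.
    - exists z; split.
      + destruct (Req_dec z (x0 - rho)) as [->|n1]; [lra|].
        destruct (Req_dec z (x0 + rho)) as [->|n2]; [lra|].
        apply Rabs_def1; lra.
      + destruct sgc; subst sg; lra. }
  (* Outside [E] the chosen value carries no information; all statements about [g] are restricted to
     [E]. *)
  set (g := fun e : R * R => epsilon (inhabits 0) (fun x => Rabs (x - x0) < rho /\ f (x, snd e) = fst e)).
  assert (gP : forall e, E e -> Rabs (g e - x0) < rho /\ f (g e, snd e) = fst e).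
  { intros e He; exact (epsilon_spec (inhabits 0) _ (solv e He)). }
  set (G := fun e : R * R => (g e, snd e)).
  assert (oE : open E).
  { exact (open_and _ _ (open_fst_interval s0 eta) (open_snd_interval y0 delta)). }
  assert (GD : forall e, E e -> D (G e)).
  { intros e He; destruct (gP e He) as [k1 _]; destruct He as [_ k2].
    apply HR; lra. }
  assert (cg : forall e, E e -> continuous g e).
  { intros e He; destruct (gP e He) as [k1 k2].
    apply filterlim_locally; intros ep.
    (* The changes of the first coordinate of [e] and of the height contribute at most half each;
       dividing by the slope bound [m] in [lip] leaves [ep]. *)
    assert (Hep : 0 < m * ep / 2) by (pose proof (cond_pos ep); apply Rdiv_lt_0_compat; [apply Rmult_lt_0_compat; lra|lra]).
    assert (c2 : continuous (fun p : R * R => f (g e, snd p)) e).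
    { apply (continuous_comp snd (fun t => f (g e, t))); [exact (continuous_snd_pair e)|].
      apply (continuous_slice2 f (G e)), cf, GD, He. }
    generalize (filter_and _ _ (oE e He) (filter_and _ _
      (proj1 (filterlim_locally _ _) c2 (mkposreal _ Hep))
      (proj1 (filterlim_locally _ _) (continuous_fst_pair e) (mkposreal _ Hep)))).
    refine (filter_imp _ _ (fun e' : R * R => _)); intros [He' [h1 h2]].
    change (Rabs (f (g e, snd e') - f (g e, snd e)) < m * ep / 2) in h1.
    change (Rabs (fst e' - fst e) < m * ep / 2) in h2.
    change (Rabs (g e' - g e) < ep).
    destruct (gP e' He') as [k1' k2'].
    assert (hy : Rabs (snd e' - y0) <= rho) by (destruct He' as [_ h]; lra).
    pose proof (lip (g e) (g e') (snd e') ltac:(lra) ltac:(lra) hy) as L.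
    rewrite k2' in L. rewrite k2 in h1.
    assert (Rabs (fst e' - f (g e, snd e')) < m * ep).
    { replace (fst e' - f (g e, snd e')) with ((fst e' - fst e) - (f (g e, snd e') - fst e)) by ring.
      eapply Rle_lt_trans; [apply Rabs_triang|]. rewrite Rabs_Ropp; lra. }
    apply Rmult_lt_reg_l with m; lra. }
  assert (cG : forall e, E e -> continuous G e).
  { intros e He; apply continuous_pairing; [exact (cg e He)|exact (continuous_snd_pair e)]. }
  assert (nz : forall e, E e -> pd1 f (G e) <> 0).
  { intros e He z. destruct (gP e He) as [k1 _]; destruct He as [_ k2].
    destruct (HR (g e) (snd e)) as [_ k3]; [lra|lra|].
    change (pd1 f (g e, snd e) = 0) in z; rewrite z in k3; lra. }
  (* The mean value theorem at the height [snd e'], between [g e] and [g e'], combined with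
     [f (g e', snd e') = fst e']. Restricted to either coordinate line it has the shape required by
     [is_derive_of_slope]. *)
  assert (slope : forall e, E e -> forall eps : posreal, locally e (fun e' =>
    exists Q, Rabs (Q - pd1 f (G e)) < eps /\
      (g e' - g e) * Q = fst e' - f (g e, snd e'))).
  { intros e He eps.
    destruct (proj1 (filterlim_locally _ _) (cf1 _ (GD e He)) eps) as [d Hd].
    generalize (filter_and _ _ (oE e He) (proj1 (filterlim_locally _ _) (cG e He) d)).
    refine (filter_imp _ _ (fun e' : R * R => _)); intros [He' [h1 h2]].
    change (Rabs (g e' - g e) < d) in h1. change (Rabs (snd e' - snd e) < d) in h2.
    destruct (gP e He) as [k1 k2], (gP e' He') as [k1' k2'].
    assert (hy : Rabs (snd e' - y0) <= rho) by (destruct He' as [_ h]; lra).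
    destruct (mvt_slice1 (fun q => Rabs (fst q - x0) <= rho /\ Rabs (snd q - y0) <= rho) f (g e) (g e') (snd e'))
      as [t [t1 t2]].
    - intros t Ht; simpl; split; [|exact hy].
      apply Rabs_def2 in k1, k1'. revert Ht; unfold Rmin, Rmax; destruct Rle_dec; intros Ht; apply Rabs_le; lra.
    - intros n; apply Ck2_subset with D; [|apply Hf].
      intros [x1 y1] [l1 l2]; apply HR; auto.
    - exists (pd1 f (t, snd e')); split.
      + apply (Hd (t, snd e')). apply ball_pair; split; [|exact h2].
        apply Rabs_between with (2 := t1); exact h1.
      + rewrite Rmult_comm, <- t2, k2'; reflexivity. }
  assert (g1 : forall e, E e -> is_pd1 g e (/ pd1 f (G e))).
  { intros [s y] He. replace (/ pd1 f (G (s, y))) with (1 / pd1 f (G (s, y))) by (field; auto).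
    apply (is_derive_of_slope (fun s => g (s, y)) (fun s => s) s); [apply (is_derive_id (K := R_AbsRing))|auto|].
    intros eps; generalize (locally_slice1 _ _ (slope _ He eps)); apply filter_imp.
    intros s' [Q [q1 q2]]; exists Q; split; [exact q1|].
    change ((g (s', y) - g (s, y)) * Q = s' - s).
    rewrite (q2 : (g (s', y) - g (s, y)) * Q = s' - f (g (s, y), y)), (proj2 (gP (s, y) He) : f (g (s, y), y) = s); reflexivity. }
  assert (g2 : forall e, E e -> is_pd2 g e (- pd2 f (G e) / pd1 f (G e))).
  { intros [s y] He.
    apply (is_derive_of_slope (fun y' => g (s, y')) (fun y' => - f (g (s, y), y')) y); [|auto|].
    - apply (is_derive_opp (V := R_NormedModule) (fun y' => f (g (s, y), y')) y).
      exact (Ck2_is_pd2 0 D f (G (s, y)) (Hf _) (GD _ He)).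
    - intros eps; generalize (locally_slice2 _ _ (slope _ He eps)); apply filter_imp.
      intros y' [Q [q1 q2]]; exists Q; split; [exact q1|].
      change ((g (s, y') - g (s, y)) * Q = - f (g (s, y), y') - - f (g (s, y), y)).
      rewrite (q2 : (g (s, y') - g (s, y)) * Q = s - f (g (s, y), y')),
        (proj2 (gP (s, y) He) : f (g (s, y), y) = s); ring. }
  assert (smooth_g : smooth2 E g).
  { intros n; induction n as [|n IH]; [exact cg|].
    assert (cS : forall h, smooth2 D h -> Ck2 n E (fun e => h (G e))).
    { intros h Hh; apply Ck2_comp with D; auto; simpl; apply Ck2_snd; auto. }
    assert (f1 : smooth2 D (pd1 f)) by (intros k; apply (Hf (S k))).
    assert (f2 : smooth2 D (pd2 f)) by (intros k; apply (Hf (S k))).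
    apply Ck2_S_intro with (fun e => / pd1 f (G e)) (fun e => - pd2 f (G e) / pd1 f (G e)); auto.
    - apply Ck2_inv; auto.
    - apply Ck2_div; auto. apply Ck2_opp; auto. }
  (* The last condition confines [q] to the strip where [f] is injective in its first variable; this
     is what makes [G] a left inverse. *)
  set (D' := fun q : R * R => (D q /\ E (f q, snd q)) /\ Rabs (fst q - x0) < rho).
  exists D', E, G.
  assert (D0 : D' (x0, y0)).
  { split; [split; [exact Hq0|]|].
    - split; simpl; [fold s0|]; rewrite Rminus_diag, Rabs_R0; [exact Heta|apply cond_pos].
    - simpl; rewrite Rminus_diag, Rabs_R0; exact Hrho. }
  split; [exact D0|]; split; [intros q [[H _] _]; exact H|].
  assert (cF : forall q, D q -> continuous (fun q => (f q, snd q)) q).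
  { intros q Hq; apply continuous_pairing; [exact (cf q Hq)|exact (continuous_snd_pair q)]. }
  assert (oD' : open D').
  { refine (open_and _ _ _ _).
    - apply (open_preimage D E (fun q => (f q, snd q))); auto.
    - apply open_fst_interval. }
  constructor; auto.
  - intros q [[_ H] _]; exact H.
  - intros e He; destruct (gP e He) as [k1 k2]. split; [|exact k1].
    split; [auto|]. simpl. unfold G; rewrite k2. rewrite <- surjective_pairing; exact He.
  - intros [x y] [[k1 k2] k3]; unfold G; simpl in *.
    destruct (gP _ k2) as [l1 l2]; simpl in l2.
    f_equal.
    assert (hy : Rabs (y - y0) <= rho) by (destruct k2 as [_ h]; simpl in h; lra).
    pose proof (lip x (g (f (x, y), y)) y ltac:(lra) ltac:(lra) hy) as L.
    rewrite l2, Rminus_diag, Rabs_R0 in L.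
    assert (Rabs (g (f (x, y), y) - x) = 0).
    { pose proof (Rabs_pos (g (f (x, y), y) - x)). nra. }
    apply Rminus_diag_uniq. revert H; unfold Rabs; destruct Rcase_abs; lra.
  - intros e He; unfold G; simpl; rewrite (proj2 (gP e He)), <- surjective_pairing; reflexivity.
  - intros n; apply Ck2_subset with D; [intros q [[H _] _]; exact H|apply Hf].
  - intros n; apply Ck2_snd; auto.
  - intros n; apply Ck2_snd; auto.
Qed.

Lemma diffeo_sym D E F G : diffeo D E F G -> diffeo E D G F.
Proof. intros [d1 d2 d3 d4 d5 d6 d7 d8 d9 d10]; constructor; assumption. Qed.

Definition jac (F : R * R -> R * R) (q : R * R) : R :=
  pd1 (fun p => fst (F p)) q * pd2 (fun p => snd (F p)) q -
  pd2 (fun p => fst (F p)) q * pd1 (fun p => snd (F p)) q.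

(* [F] is the shear [(x, y) |-> (F_1, y)] followed by the shear
   [(s, y) |-> (s, h (s, y))], the latter conjugated by [swap]. *)
Lemma local_inverse_aux (D : R * R -> Prop) (F : R * R -> R * R) (q0 : R * R) :
  open D -> D q0 ->
  smooth2 D (fun q => fst (F q)) -> smooth2 D (fun q => snd (F q)) ->
  jac F q0 <> 0 -> pd1 (fun q => fst (F q)) q0 <> 0 ->
  exists D' E G, D' q0 /\ (forall q, D' q -> D q) /\ diffeo D' E F G.
Proof.
  intros HD Hq0 H1 H2 Hj Hp.
  destruct (shear_inverse D (fun q => fst (F q)) q0) as [D1 [E1 [G1 [D10 [D1D d1]]]]]; auto.
  set (S1 := fun q : R * R => (fst (F q), snd q)) in d1.
  set (h := fun e => snd (F (G1 e))).
  assert (oE1 : open E1) by apply d1. assert (oD1 : open D1) by apply d1.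
  assert (sh : smooth2 E1 h).
  { apply (smooth2_comp D E1 G1 (fun q => snd (F q))); auto; try apply d1.
    intros e He; apply D1D; apply d1; exact He. }
  assert (hS : forall q, D1 q -> h (S1 q) = snd (F q)).
  { intros q Hq; unfold h; rewrite (diffeo_GF _ _ _ _ d1); auto. }
  set (e0 := S1 q0). assert (He0 : E1 e0) by (apply d1; exact D10).
  (* Since [F_2] is [h] composed with [S1], the chain rule gives
     [jac F q0 = pd1 F_1 q0 * pd2 h e0]. *)
  assert (Hh : pd2 h e0 <> 0).
  { intros z; apply Hj; unfold jac.
    assert (i1 : is_pd1 (fun q => fst (S1 q)) q0 (pd1 (fun q => fst (F q)) q0))
      by (exact (Ck2_is_pd1 0 D _ q0 (H1 _) Hq0)).
    assert (i2 : is_pd2 (fun q => fst (S1 q)) q0 (pd2 (fun q => fst (F q)) q0))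
      by (exact (Ck2_is_pd2 0 D _ q0 (H1 _) Hq0)).
    assert (j1 : is_pd1 (fun q => snd (S1 q)) q0 0)
      by exact (is_derive_const (V := R_NormedModule) (snd q0) (fst q0)).
    assert (j2 : is_pd2 (fun q => snd (S1 q)) q0 1)
      by exact (is_derive_id (K := R_AbsRing) (snd q0)).
    pose proof (is_pd1_unique _ _ _ (is_pd1_comp E1 h S1 q0 _ _ oE1 He0 (sh 1%nat) i1 j1)) as u1.
    pose proof (is_pd2_unique _ _ _ (is_pd2_comp E1 h S1 q0 _ _ oE1 He0 (sh 1%nat) i2 j2)) as u2.
    rewrite (pd1_ext_open D1 _ _ q0 oD1 D10 hS) in u1.
    rewrite (pd2_ext_open D1 _ _ q0 oD1 D10 hS) in u2.
    fold e0 in u1, u2; rewrite u1, u2, z; ring. }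
  assert (oswap : open (fun q => E1 (swap q))) by apply (diffeo_swap E1 oE1).
  destruct (shear_inverse (fun q => E1 (swap q)) (fun q => h (swap q)) (swap e0))
    as [D2 [E2 [G2 [D20 [D2D d2]]]]].
  - exact oswap.
  - rewrite swap_swap; exact He0.
  - apply (smooth2_comp E1 (fun q => E1 (swap q)) swap h); auto; apply (diffeo_swap E1 oE1).
  - exact Hh.
  - set (S2 := fun q : R * R => (h (swap q), snd q)) in d2.
    assert (oD2 : open D2) by apply d2. assert (oE2 : open E2) by apply d2.
    assert (dd := diffeo_restrict D1 E1 S1 G1 (fun e => D2 (swap e))
      (diffeo_open_dom _ _ _ _ (diffeo_swap D2 oD2))
      (fun e He => eq_ind _ E1 (D2D _ He) _ (swap_swap e)) d1).
    assert (d3 := diffeo_comp _ _ _ _ _ _ _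
      (diffeo_comp _ _ _ _ _ _ _ (diffeo_comp _ _ _ _ _ _ _ dd (diffeo_swap D2 oD2)) d2)
      (diffeo_sym _ _ _ _ (diffeo_swap E2 oE2))).
    eexists; eexists; eexists; split; [|split].
    3: apply diffeo_ext with (2 := d3).
    + split; [exact D10|exact D20].
    + intros q [Hq _]; auto.
    + intros q [Hq _]; unfold S2, swap at 1; simpl.
      rewrite (swap_swap (S1 q)), hS by exact Hq.
      rewrite <- surjective_pairing; reflexivity.
Qed.

(** If the first partial derivative of [F_1] vanishes at [q0], the Jacobian forces the second one
    not to; precomposing with [swap] exchanges them and only changes the sign of the Jacobian. *)
Lemma local_inverse (D : R * R -> Prop) (F : R * R -> R * R) (q0 : R * R) :
  open D -> D q0 ->
  smooth2 D (fun q => fst (F q)) -> smooth2 D (fun q => snd (F q)) -> jac F q0 <> 0 ->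
  exists D' E G, D' q0 /\ (forall q, D' q -> D q) /\ diffeo D' E F G.
Proof.
  intros HD Hq0 H1 H2 Hj.
  destruct (Req_dec (pd1 (fun q => fst (F q)) q0) 0) as [z|nz];
    [|apply local_inverse_aux; auto].
  assert (ds := diffeo_swap D HD).
  destruct (local_inverse_aux (fun q => D (swap q)) (fun q => F (swap q)) (swap q0))
    as [D' [E [G [h1 [h2 h3]]]]].
  - apply ds.
  - rewrite swap_swap; exact Hq0.
  - apply (smooth2_comp D _ swap (fun q => fst (F q))); auto; apply ds.
  - apply (smooth2_comp D _ swap (fun q => snd (F q))); auto; apply ds.
  - unfold jac in *; destruct q0 as [x y].
    change (pd2 (fun p => fst (F p)) (x, y) * pd1 (fun p => snd (F p)) (x, y) -
      pd1 (fun p => fst (F p)) (x, y) * pd2 (fun p => snd (F p)) (x, y) <> 0).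
    lra.
  - unfold jac in Hj; destruct q0 as [x y].
    change (pd2 (fun p => fst (F p)) (x, y) <> 0); intros z'; apply Hj; rewrite z, z'; ring.
  - assert (oD' : open D') by apply h3.
    assert (d := diffeo_comp _ _ _ _ _ _ _ (diffeo_swap D' oD') h3).
    exists (fun q => D' (swap q)), E, (fun e => swap (G e)); split; [exact h1|split].
    + intros q Hq; rewrite <- (swap_swap q); apply h2, Hq.
    + apply diffeo_ext with (2 := d). intros q _; rewrite swap_swap; reflexivity.
Qed.

(** The chain rule for [F (G e) = e] at [e = F q]: the product of the two Jacobian matrices is the
    identity, entry by entry. *)
Lemma diffeo_jacobian D E F G q : diffeo D E F G -> D q ->
  let f1 := fun p => fst (F p) in let f2 := fun p => snd (F p) in
  let g1 := fun p => fst (G p) in let g2 := fun p => snd (G p) in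
  pd1 f1 q * pd1 g1 (F q) + pd2 f1 q * pd1 g2 (F q) = 1 /\
  pd1 f1 q * pd2 g1 (F q) + pd2 f1 q * pd2 g2 (F q) = 0 /\
  pd1 f2 q * pd1 g1 (F q) + pd2 f2 q * pd1 g2 (F q) = 0 /\
  pd1 f2 q * pd2 g1 (F q) + pd2 f2 q * pd2 g2 (F q) = 1.
Proof.
  intros [d1 d2 d3 d4 d5 d6 d7 d8 d9 d10] Hq f1 f2 g1 g2.
  assert (He : E (F q)) by auto.
  assert (HG : D (G (F q))) by auto.
  assert (j1 := Ck2_is_pd1 0 E g1 _ (d9 _) He). assert (j2 := Ck2_is_pd2 0 E g1 _ (d9 _) He).
  assert (k1 := Ck2_is_pd1 0 E g2 _ (d10 _) He). assert (k2 := Ck2_is_pd2 0 E g2 _ (d10 _) He).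
  assert (a1 := is_pd1_unique _ _ _ (is_pd1_comp D f1 G _ _ _ d1 HG (d7 _) j1 k1)).
  assert (a2 := is_pd2_unique _ _ _ (is_pd2_comp D f1 G _ _ _ d1 HG (d7 _) j2 k2)).
  assert (b1 := is_pd1_unique _ _ _ (is_pd1_comp D f2 G _ _ _ d1 HG (d8 _) j1 k1)).
  assert (b2 := is_pd2_unique _ _ _ (is_pd2_comp D f2 G _ _ _ d1 HG (d8 _) j2 k2)).
  rewrite d5 in a1, a2, b1, b2 by auto.
  rewrite <- a1, <- a2, <- b1, <- b2; unfold f1, f2.
  assert (e1 : forall e, E e -> fst (F (G e)) = fst e) by (intros; rewrite d6; auto).
  assert (e2 : forall e, E e -> snd (F (G e)) = snd e) by (intros; rewrite d6; auto).
  rewrite (pd1_ext_open E _ _ _ d2 He e1), (pd2_ext_open E _ _ _ d2 He e1),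
    (pd1_ext_open E _ _ _ d2 He e2), (pd2_ext_open E _ _ _ d2 He e2).
  repeat split.
  - exact (Derive_id (fst (F q))).
  - exact (Derive_const (fst (F q)) (snd (F q))).
  - exact (Derive_const (snd (F q)) (fst (F q))).
  - exact (Derive_id (snd (F q))).
Qed.

(** A vector killed by the differential of the composite is sent by that of [G] to a vector killed
    by that of [r], hence to zero, and the Jacobian of [F] brings it back. For openness, the image
    of [O] is the image under [r] of its preimage by [F]. *)
Lemma local_param_reparam M D r D' E F G :
  local_param M D r -> (forall q, D' q -> D q) -> diffeo D' E F G ->
  local_param M E (fun e => r (G e)).
Proof.
  intros [oD [[sa [sb sc]] [imm [inj op]]]] S d.
  assert (DG : forall e, E e -> D (G e)) by (intros e He; apply S, d, He).
  assert (oE : open E) by apply d.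
  assert (G1 : smooth2 E (fun e => fst (G e))) by apply d.
  assert (G2 : smooth2 E (fun e => snd (G e))) by apply d.
  split; [|split; [|split; [|split]]].
  - exact oE.
  - split; [|split].
    + apply (smooth2_comp D E G (comp_a r)); auto.
    + apply (smooth2_comp D E G (comp_b r)); auto.
    + apply (smooth2_comp D E G (comp_c r)); auto.
  - intros e He k l.
    assert (j1 := Ck2_is_pd1 0 E _ _ (G1 _) He). assert (j2 := Ck2_is_pd2 0 E _ _ (G1 _) He).
    assert (k1 := Ck2_is_pd1 0 E _ _ (G2 _) He). assert (k2 := Ck2_is_pd2 0 E _ _ (G2 _) He).
    rewrite (is_pd1_unique _ _ _ (is_pd1_comp D (comp_a r) G e _ _ oD (DG e He) (sa _) j1 k1)
      : pd1 (comp_a (fun e => r (G e))) e = _).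
    rewrite (is_pd2_unique _ _ _ (is_pd2_comp D (comp_a r) G e _ _ oD (DG e He) (sa _) j2 k2)
      : pd2 (comp_a (fun e => r (G e))) e = _).
    rewrite (is_pd1_unique _ _ _ (is_pd1_comp D (comp_b r) G e _ _ oD (DG e He) (sb _) j1 k1)
      : pd1 (comp_b (fun e => r (G e))) e = _).
    rewrite (is_pd2_unique _ _ _ (is_pd2_comp D (comp_b r) G e _ _ oD (DG e He) (sb _) j2 k2)
      : pd2 (comp_b (fun e => r (G e))) e = _).
    rewrite (is_pd1_unique _ _ _ (is_pd1_comp D (comp_c r) G e _ _ oD (DG e He) (sc _) j1 k1)
      : pd1 (comp_c (fun e => r (G e))) e = _).
    rewrite (is_pd2_unique _ _ _ (is_pd2_comp D (comp_c r) G e _ _ oD (DG e He) (sc _) j2 k2)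
      : pd2 (comp_c (fun e => r (G e))) e = _).
    intros h1 h2 h3.
    set (p1 := pd1 (fun e => fst (G e)) e) in *. set (p2 := pd2 (fun e => fst (G e)) e) in *.
    set (s1 := pd1 (fun e => snd (G e)) e) in *. set (s2 := pd2 (fun e => snd (G e)) e) in *.
    destruct (imm (G e) (DG e He) (k * p1 + l * p2) (k * s1 + l * s2)) as [z1 z2];
      [rewrite <- h1; ring|rewrite <- h2; ring|rewrite <- h3; ring|].
    destruct (diffeo_jacobian _ _ _ _ (G e) d (diffeo_dom _ _ _ _ d e He)) as [m1 [m2 [m3 m4]]].
    rewrite (diffeo_FG _ _ _ _ d e He) in m1, m2, m3, m4.
    fold p1 p2 s1 s2 in m1, m2, m3, m4.
    set (x1 := pd1 (fun p => fst (F p)) (G e)) in *. set (x2 := pd2 (fun p => fst (F p)) (G e)) in *.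
    set (t1 := pd1 (fun p => snd (F p)) (G e)) in *. set (t2 := pd2 (fun p => snd (F p)) (G e)) in *.
    split.
    + transitivity (x1 * (k * p1 + l * p2) + x2 * (k * s1 + l * s2)); [|rewrite z1, z2; ring].
      transitivity (k * (x1 * p1 + x2 * s1) + l * (x1 * p2 + x2 * s2)); [rewrite m1, m2|]; ring.
    + transitivity (t1 * (k * p1 + l * p2) + t2 * (k * s1 + l * s2)); [|rewrite z1, z2; ring].
      transitivity (k * (t1 * p1 + t2 * s1) + l * (t1 * p2 + t2 * s2)); [rewrite m3, m4|]; ring.
  - intros e e' He He' Heq.
    rewrite <- (diffeo_FG _ _ _ _ d e He), <- (diffeo_FG _ _ _ _ d e' He').
    f_equal; apply inj; auto.
  - intros O oO OE.
    destruct (op (fun q => D' q /\ O (F q))) as [W [oW HW]].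
    + apply open_preimage; [apply d|exact oO|].
      intros q Hq; apply smooth2_continuous_pair with D'; auto; apply d.
    + intros q [Hq _]; auto.
    + exists W; split; [exact oW|]. intros u; rewrite HW; split.
      * intros [q [[Hq1 Hq2] Hu]]; exists (F q); split; [exact Hq2|].
        rewrite (diffeo_GF _ _ _ _ d q Hq1); exact Hu.
      * intros [e [He Hu]]; exists (G e); split; [|exact Hu].
        split; [apply d, OE, He|]. rewrite (diffeo_FG _ _ _ _ d e (OE e He)); exact He.
Qed.

(** * Algebra of the characteristic forms *)

Lemma quadratic_zero x y z A B C : x <> y -> y <> z -> x <> z ->
  A * x ^ 2 + B * x + C = 0 -> A * y ^ 2 + B * y + C = 0 -> A * z ^ 2 + B * z + C = 0 ->
  A = 0 /\ B = 0 /\ C = 0.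
Proof.
  intros hxy hyz hxz hx hy hz.
  assert (e1 : A * (x + y) + B = 0).
  { apply Rmult_eq_reg_l with (x - y); [|lra].
    transitivity ((A * x ^ 2 + B * x + C) - (A * y ^ 2 + B * y + C)); [ring|lra]. }
  assert (e2 : A * (x + z) + B = 0).
  { apply Rmult_eq_reg_l with (x - z); [|lra].
    transitivity ((A * x ^ 2 + B * x + C) - (A * z ^ 2 + B * z + C)); [ring|lra]. }
  assert (A = 0).
  { apply Rmult_eq_reg_l with (y - z); [|lra].
    transitivity ((A * (x + y) + B) - (A * (x + z) + B)); [ring|lra]. }
  subst A; assert (B = 0) by lra; subst B; repeat split; lra.
Qed.

(** The cubic minus [(v - x) (v - y) (v - z)] has degree at most two and three distinct zeros. *)
Lemma vieta a b c x y z : x <> y -> y <> z -> x <> z ->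
  x ^ 3 + a * x ^ 2 - 2 * b * x + c = 0 -> y ^ 3 + a * y ^ 2 - 2 * b * y + c = 0 ->
  z ^ 3 + a * z ^ 2 - 2 * b * z + c = 0 ->
  a = - (x + y + z) /\ b = - (x * y + y * z + z * x) / 2 /\ c = - (x * y * z).
Proof.
  intros hxy hyz hxz hx hy hz.
  destruct (quadratic_zero x y z (a + (x + y + z)) (- 2 * b - (x * y + y * z + z * x)) (c + x * y * z))
    as [e1 [e2 e3]]; auto.
  - rewrite <- hx; ring.
  - rewrite <- hy; ring.
  - rewrite <- hz; ring.
  - repeat split; lra.
Qed.

(* [aX] stands for the coefficient of [da /\ X], and so on: the hypotheses say
   that [omega^i /\ (X + v^i T) = 0]; the conclusion is the system in the coframe [X, T]. *)
Lemma eigenforms_system a b c x y z aX bX cX aT bT cT : x <> y -> y <> z -> x <> z ->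
  (forall v, v = x \/ v = y \/ v = z ->
     v ^ 3 + a * v ^ 2 - 2 * b * v + c = 0 /\
     (v ^ 2 + a * v - 2 * b) * aX + (v + a) * bX + cX +
     v * ((v ^ 2 + a * v - 2 * b) * aT + (v + a) * bT + cT) = 0) ->
  aX + bT = 0 /\ bX + cT = 0 /\ cX + (2 * b * bT - a * cT - c * aT) = 0.
Proof.
  intros hxy hyz hxz H.
  (* Subtracting [aT] times the characteristic polynomial removes the cubic term; a quadratic with
     three distinct zeros has zero coefficients. *)
  assert (K : forall v, v = x \/ v = y \/ v = z ->
    (aX + bT) * v ^ 2 + (a * (aX + bT) + (bX + cT)) * v +
    (- 2 * b * aX + a * bX + cX - c * aT) = 0).
  { intros v hv; destruct (H v hv) as [h1 h2].
    rewrite <- h2.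
    transitivity ((v ^ 2 + a * v - 2 * b) * aX + (v + a) * bX + cX +
     v * ((v ^ 2 + a * v - 2 * b) * aT + (v + a) * bT + cT) -
     (v ^ 3 + a * v ^ 2 - 2 * b * v + c) * aT); [ring|rewrite h1; ring]. }
  destruct (quadratic_zero x y z _ _ _ hxy hyz hxz (K x ltac:(auto)) (K y ltac:(auto))
    (K z ltac:(auto))) as [e1 [e2 e3]].
  assert (f1 : aX = - bT) by lra.
  assert (f2 : bX = - cT) by (rewrite e1 in e2; lra).
  subst aX bX; repeat split; lra.
Qed.

(* The first integrals: on a solution the forms [(v^j - v^k) (dx + v^i dt)] are
   closed.  Here [xX] is the coefficient of [dx /\ X] for the velocity [x], etc. *)
Lemma closed_identity x y z xX yX zX xT yT zT : x <> y -> y <> z -> x <> z ->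
  (xX + yX + zX) + (xT * y + x * yT + yT * z + y * zT + zT * x + z * xT) / 2 = 0 ->
  (xX * y + x * yX + yX * z + y * zX + zX * x + z * xX) / 2 +
    (xT * y * z + x * yT * z + x * y * zT) = 0 ->
  (xX * y * z + x * yX * z + x * y * zX)
    - (x * y + y * z + z * x) * (xT * y + x * yT + yT * z + y * zT + zT * x + z * xT) / 2
    + (x + y + z) * (xT * y * z + x * yT * z + x * y * zT) + x * y * z * (xT + yT + zT) = 0 ->
  (yX - zX) + ((yT - zT) * x + (y - z) * xT) = 0.
Proof.
  intros hxy hyz hxz r1 r2 r3.
  match type of r1 with ?A = 0 => set (R1 := A) in * end.
  match type of r2 with ?A = 0 => set (R2 := A) in * end.
  match type of r3 with ?A = 0 => set (R3 := A) in * end.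
  (* These are the derivatives of the characteristic polynomial at the roots [y] and [z]. By
     implicit differentiation, the weights [y^2], [-2 y], [1] over [py] isolate [yX] among the
     [X]-terms, and likewise for [z]; the difference of the two combinations is the claim. *)
  set (py := (y - x) * (y - z)). set (pz := (z - x) * (z - y)).
  transitivity ((y ^ 2 / py - z ^ 2 / pz) * R1 - 2 * (y / py - z / pz) * R2 + (1 / py - 1 / pz) * R3).
  - unfold R1, R2, R3, py, pz; field; repeat split; lra.
  - rewrite r1, r2, r3; ring.
Qed.

(** In coordinates with [X = dx] and [T = dt], the relation [df /\ X + dh /\ T = 0] reads
    [f_t = h_x]. The [p] and [s] are the entries of the Jacobian matrix inverse to that of [(x, t)],
    and [d] is its determinant; Cramer's rule is used multiplied out, without division. *)
Lemma inverse_jacobian_transport X1 X2 T1 T2 p1 p2 s1 s2 f1 f2 h1 h2 :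
  X1 * p1 + X2 * s1 = 1 -> X1 * p2 + X2 * s2 = 0 ->
  T1 * p1 + T2 * s1 = 0 -> T1 * p2 + T2 * s2 = 1 ->
  (f1 * X2 - f2 * X1) + (h1 * T2 - h2 * T1) = 0 ->
  f1 * p2 + f2 * s2 = h1 * p1 + h2 * s1.
Proof.
  intros m1 m2 m3 m4 H. set (d := p1 * s2 - p2 * s1).
  assert (eX2 : X2 * d = - p2).
  { transitivity (p1 * (X1 * p2 + X2 * s2) - p2 * (X1 * p1 + X2 * s1)); [unfold d; ring|].
    rewrite m1, m2; ring. }
  assert (eX1 : X1 * d = s2).
  { transitivity (s2 * (X1 * p1 + X2 * s1) - s1 * (X1 * p2 + X2 * s2)); [unfold d; ring|].
    rewrite m1, m2; ring. }
  assert (eT2 : T2 * d = p1).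
  { transitivity (p1 * (T1 * p2 + T2 * s2) - p2 * (T1 * p1 + T2 * s1)); [unfold d; ring|].
    rewrite m3, m4; ring. }
  assert (eT1 : T1 * d = - s1).
  { transitivity (s2 * (T1 * p1 + T2 * s1) - s1 * (T1 * p2 + T2 * s2)); [unfold d; ring|].
    rewrite m3, m4; ring. }
  apply Rminus_diag_uniq.
  transitivity (- d * ((f1 * X2 - f2 * X1) + (h1 * T2 - h2 * T1))); [|rewrite H; ring].
  transitivity (- f1 * (X2 * d) + f2 * (X1 * d) - h1 * (T2 * d) + h2 * (T1 * d)); [|ring].
  rewrite eX1, eX2, eT1, eT2; ring.
Qed.

(** * Characteristic velocities and eigenforms in local coordinates on a surface *)

Lemma local_param_image M D r q : local_param M D r -> D q -> M (r q).
Proof.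
  intros [oD [_ [_ [_ op]]]] Hq; destruct (op D oD (fun q h => h)) as [W [_ HW]].
  apply (HW (r q)); exists q; auto.
Qed.

Lemma local_param_continuous M D r q : local_param M D r -> D q -> continuous r q.
Proof.
  intros [_ [[sa [sb sc]] _]] Hq; apply filterlim_locally; intros e.
  generalize (proj1 (filterlim_locally _ _) (sa 0%nat q Hq) e).
  generalize (proj1 (filterlim_locally _ _) (sb 0%nat q Hq) e).
  generalize (proj1 (filterlim_locally _ _) (sc 0%nat q Hq) e).
  intros k3 k2 k1; generalize (filter_and _ _ k1 (filter_and _ _ k2 k3)).
  apply filter_imp; intros p [a [b c]]; split; [split|]; assumption.
Qed.

Lemma char_poly_comp r q z :
  char_poly (r q) z = z ^ 3 + comp_a r q * z ^ 2 - 2 * comp_b r q * z + comp_c r q.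
Proof. unfold char_poly, comp_a, comp_b, comp_c; destruct (r q) as [[a b] c]; reflexivity. Qed.

Lemma pullback_omega v r q :
  let w := v (r q) in
  let wa := w ^ 2 + comp_a r q * w - 2 * comp_b r q in
  let wb := w + comp_a r q in
  pullback r (omega v) q =
  (wa * pd1 (comp_a r) q + wb * pd1 (comp_b r) q + pd1 (comp_c r) q,
   wa * pd2 (comp_a r) q + wb * pd2 (comp_b r) q + pd2 (comp_c r) q).
Proof.
  cbv zeta; unfold pullback, omega.
  generalize (pd1 (comp_a r) q) (pd1 (comp_b r) q) (pd1 (comp_c r) q)
    (pd2 (comp_a r) q) (pd2 (comp_b r) q) (pd2 (comp_c r) q); intros.
  unfold comp_a, comp_b; destruct (r q) as [[a b] c]; simpl; f_equal; ring.
Qed.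

(** By Vieta's formulas the derivative of the characteristic polynomial at [v] is
    [(v - v') (v - v'')], which is nonzero, so the continuous root is smooth. *)
Lemma velocity_smooth (U : R * R * R -> Prop) v v' v'' M D r :
  (forall u, U u -> continuous v u) ->
  (forall u, U u -> char_poly u (v u) = 0 /\ char_poly u (v' u) = 0 /\ char_poly u (v'' u) = 0) ->
  (forall u, U u -> v u <> v' u /\ v' u <> v'' u /\ v u <> v'' u) ->
  (forall u, M u -> U u) -> local_param M D r ->
  smooth2 D (fun q => v (r q)).
Proof.
  intros cv rt dist MU lp.
  assert (UD : forall q, D q -> U (r q)) by (intros q Hq; apply MU, (local_param_image M D r q lp Hq)).
  destruct (lp) as [oD [[sa [sb sc]] _]].
  apply (cubic_root_smooth D (fun q => v (r q)) (comp_a r) (comp_b r) (comp_c r)); auto.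
  - intros q Hq; apply (continuous_comp r v); [|apply cv, UD, Hq].
    apply (local_param_continuous M D r q lp Hq).
  - intros q Hq; rewrite <- char_poly_comp; apply rt, UD, Hq.
  - intros q Hq; destruct (dist _ (UD q Hq)) as [d1 [d2 d3]], (rt _ (UD q Hq)) as [r1 [r2 r3]].
    rewrite char_poly_comp in r1, r2, r3.
    destruct (vieta _ _ _ _ _ _ d1 d2 d3 r1 r2 r3) as [e1 [e2 _]].
    rewrite e1, e2.
    replace (_ - _) with ((v (r q) - v' (r q)) * (v (r q) - v'' (r q))) by field.
    apply Rmult_integral_contrapositive; split; lra.
Qed.

Lemma flux_pd1 D r q : D q ->
  smooth2 D (comp_a r) -> smooth2 D (comp_b r) -> smooth2 D (comp_c r) ->
  pd1 (fun p => comp_b r p ^ 2 - comp_a r p * comp_c r p) q =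
  2 * comp_b r q * pd1 (comp_b r) q - comp_a r q * pd1 (comp_c r) q
    - comp_c r q * pd1 (comp_a r) q.
Proof.
  intros Hq sa sb sc.
  assert (a1 := Ck2_is_pd1 0 D _ _ (sa _) Hq). assert (b1 := Ck2_is_pd1 0 D _ _ (sb _) Hq).
  assert (c1 := Ck2_is_pd1 0 D _ _ (sc _) Hq).
  assert (H := is_pd1_unique _ _ _ (is_pd1_minus _ _ _ _ _ (is_pd1_mult _ _ _ _ _ b1
    (is_pd1_mult _ _ _ _ _ b1 (is_derive_const (V := R_NormedModule) 1 (fst q) : is_pd1 (fun _ => 1) q 0))) (is_pd1_mult _ _ _ _ _ a1 c1))).
  transitivity (pd1 (fun p => comp_b r p * (comp_b r p * 1) - comp_a r p * comp_c r p) q);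
    [reflexivity|].
  rewrite H; ring.
Qed.

Lemma vieta_pd1 D a b c x y z : open D ->
  smooth2 D x -> smooth2 D y -> smooth2 D z ->
  (forall q, D q -> a q = - (x q + y q + z q) /\
     b q = - (x q * y q + y q * z q + z q * x q) / 2 /\ c q = - (x q * y q * z q)) ->
  forall q, D q ->
  let x' := pd1 x q in let y' := pd1 y q in let z' := pd1 z q in
  pd1 a q = - (x' + y' + z') /\
  pd1 b q = - (x' * y q + x q * y' + y' * z q + y q * z' + z' * x q + z q * x') / 2 /\
  pd1 c q = - (x' * y q * z q + x q * y' * z q + x q * y q * z').
Proof.
  intros oD sx sy sz V q Hq x' y' z'.
  assert (hx := Ck2_is_pd1 0 D _ _ (sx _) Hq : is_pd1 x q x').
  assert (hy := Ck2_is_pd1 0 D _ _ (sy _) Hq : is_pd1 y q y').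
  assert (hz := Ck2_is_pd1 0 D _ _ (sz _) Hq : is_pd1 z q z').
  assert (hk : forall k : R, is_pd1 (fun _ => k) q 0)
    by (intros k; exact (is_derive_const (V := R_NormedModule) k (fst q))).
  repeat split.
  - rewrite (pd1_ext_open D a (fun q => (-1) * (x q + y q + z q)) q oD Hq)
      by (intros p Hp; rewrite (proj1 (V p Hp)); ring).
    etransitivity; [exact (is_pd1_unique _ _ _ (is_pd1_mult _ _ _ _ _ (hk (-1))
      (is_pd1_plus _ _ _ _ _ (is_pd1_plus _ _ _ _ _ hx hy) hz)))|cbv beta; ring].
  - rewrite (pd1_ext_open D b (fun q => (-1/2) * (x q * y q + y q * z q + z q * x q)) q oD Hq)
      by (intros p Hp; rewrite (proj1 (proj2 (V p Hp))); field).
    etransitivity; [exact (is_pd1_unique _ _ _ (is_pd1_mult _ _ _ _ _ (hk (-1/2))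
      (is_pd1_plus _ _ _ _ _ (is_pd1_plus _ _ _ _ _ (is_pd1_mult _ _ _ _ _ hx hy)
        (is_pd1_mult _ _ _ _ _ hy hz)) (is_pd1_mult _ _ _ _ _ hz hx))))|cbv beta; field].
  - rewrite (pd1_ext_open D c (fun q => (-1) * (x q * y q * z q)) q oD Hq)
      by (intros p Hp; rewrite (proj2 (proj2 (V p Hp))); ring).
    etransitivity; [exact (is_pd1_unique _ _ _ (is_pd1_mult _ _ _ _ _ (hk (-1))
      (is_pd1_mult _ _ _ _ _ (is_pd1_mult _ _ _ _ _ hx hy) hz)))|cbv beta; ring].
Qed.

Lemma vieta_pd2 D a b c x y z : open D ->
  smooth2 D x -> smooth2 D y -> smooth2 D z ->
  (forall q, D q -> a q = - (x q + y q + z q) /\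
     b q = - (x q * y q + y q * z q + z q * x q) / 2 /\ c q = - (x q * y q * z q)) ->
  forall q, D q ->
  let x' := pd2 x q in let y' := pd2 y q in let z' := pd2 z q in
  pd2 a q = - (x' + y' + z') /\
  pd2 b q = - (x' * y q + x q * y' + y' * z q + y q * z' + z' * x q + z q * x') / 2 /\
  pd2 c q = - (x' * y q * z q + x q * y' * z q + x q * y q * z').
Proof.
  intros oD sx sy sz V q Hq x' y' z'.
  assert (hx := Ck2_is_pd2 0 D _ _ (sx _) Hq : is_pd2 x q x').
  assert (hy := Ck2_is_pd2 0 D _ _ (sy _) Hq : is_pd2 y q y').
  assert (hz := Ck2_is_pd2 0 D _ _ (sz _) Hq : is_pd2 z q z').
  assert (hk : forall k : R, is_pd2 (fun _ => k) q 0)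
    by (intros k; exact (is_derive_const (V := R_NormedModule) k (snd q))).
  repeat split.
  - rewrite (pd2_ext_open D a (fun q => (-1) * (x q + y q + z q)) q oD Hq)
      by (intros p Hp; rewrite (proj1 (V p Hp)); ring).
    etransitivity; [exact (is_pd2_unique _ _ _ (is_pd2_mult _ _ _ _ _ (hk (-1))
      (is_pd2_plus _ _ _ _ _ (is_pd2_plus _ _ _ _ _ hx hy) hz)))|cbv beta; ring].
  - rewrite (pd2_ext_open D b (fun q => (-1/2) * (x q * y q + y q * z q + z q * x q)) q oD Hq)
      by (intros p Hp; rewrite (proj1 (proj2 (V p Hp))); field).
    etransitivity; [exact (is_pd2_unique _ _ _ (is_pd2_mult _ _ _ _ _ (hk (-1/2))
      (is_pd2_plus _ _ _ _ _ (is_pd2_plus _ _ _ _ _ (is_pd2_mult _ _ _ _ _ hx hy)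
        (is_pd2_mult _ _ _ _ _ hy hz)) (is_pd2_mult _ _ _ _ _ hz hx))))|cbv beta; field].
  - rewrite (pd2_ext_open D c (fun q => (-1) * (x q * y q * z q)) q oD Hq)
      by (intros p Hp; rewrite (proj2 (proj2 (V p Hp))); ring).
    etransitivity; [exact (is_pd2_unique _ _ _ (is_pd2_mult _ _ _ _ _ (hk (-1))
      (is_pd2_mult _ _ _ _ _ (is_pd2_mult _ _ _ _ _ hx hy) hz)))|cbv beta; ring].
Qed.

(* [(X1, X2)] and [(T1, T2)] are the values at [q] of two 1-forms [X], [T]; the
   three hypotheses are the system in the coframe [X, T]. *)
Lemma closed_at D a b c x y z X1 X2 T1 T2 : open D ->
  smooth2 D x -> smooth2 D y -> smooth2 D z ->
  (forall q, D q -> a q = - (x q + y q + z q) /\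
     b q = - (x q * y q + y q * z q + z q * x q) / 2 /\ c q = - (x q * y q * z q)) ->
  forall q, D q -> x q <> y q -> y q <> z q -> x q <> z q ->
  let dX f := pd1 f q * X2 - pd2 f q * X1 in
  let dT f := pd1 f q * T2 - pd2 f q * T1 in
  dX a + dT b = 0 -> dX b + dT c = 0 ->
  dX c + (2 * b q * dT b - a q * dT c - c q * dT a) = 0 ->
  (dX y - dX z) + ((dT y - dT z) * x q + (y q - z q) * dT x) = 0.
Proof.
  intros oD sx sy sz V q Hq hxy hyz hxz dX dT r1 r2 r3.
  destruct (vieta_pd1 D a b c x y z oD sx sy sz V q Hq) as [a1 [b1 c1]].
  destruct (vieta_pd2 D a b c x y z oD sx sy sz V q Hq) as [a2 [b2 c2]].
  destruct (V q Hq) as [va [vb vc]].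
  unfold dX, dT in r1, r2, r3.
  rewrite a1, a2, b1, b2 in r1; rewrite b1, b2, c1, c2 in r2.
  rewrite va, vb, vc, a1, a2, b1, b2, c1, c2 in r3.
  apply (closed_identity (x q) (y q) (z q) (dX x) (dX y) (dX z) (dT x) (dT y) (dT z));
    auto; unfold dX, dT.
  - match type of r1 with ?L = _ => transitivity (- L); [field|rewrite r1; ring] end.
  - match type of r2 with ?L = _ => transitivity (- L); [field|rewrite r2; ring] end.
  - match type of r3 with ?L = _ => transitivity (- L); [field|rewrite r3; ring] end.
Qed.

(** * Solutions and hexagonal webs *)

(** The data of one chart for the local argument. Neither [M] nor the ambient open set occurs in it,
    so it passes to any smaller open domain. *)
Record characteristic_param (D : R * R -> Prop) (r : R * R -> R * R * R)
    (v1 v2 v3 : R * R * R -> R) : Prop := {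
  cp_open : open D;
  cp_a : smooth2 D (comp_a r);
  cp_b : smooth2 D (comp_b r);
  cp_c : smooth2 D (comp_c r);
  cp_v1 : smooth2 D (fun q => v1 (r q));
  cp_v2 : smooth2 D (fun q => v2 (r q));
  cp_v3 : smooth2 D (fun q => v3 (r q));
  cp_roots : forall q, D q -> forall v, v = v1 \/ v = v2 \/ v = v3 ->
    v (r q) ^ 3 + comp_a r q * v (r q) ^ 2 - 2 * comp_b r q * v (r q) + comp_c r q = 0;
  cp_distinct : forall q, D q ->
    v1 (r q) <> v2 (r q) /\ v2 (r q) <> v3 (r q) /\ v1 (r q) <> v3 (r q);
  cp_indep12 : forall q, D q -> lin_indep_at (pullback r (omega v1)) (pullback r (omega v2)) q;
  cp_indep13 : forall q, D q -> lin_indep_at (pullback r (omega v1)) (pullback r (omega v3)) q }.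

Lemma cp_vieta D r v1 v2 v3 : characteristic_param D r v1 v2 v3 ->
  forall q, D q ->
  comp_a r q = - (v1 (r q) + v2 (r q) + v3 (r q)) /\
  comp_b r q = - (v1 (r q) * v2 (r q) + v2 (r q) * v3 (r q) + v3 (r q) * v1 (r q)) / 2 /\
  comp_c r q = - (v1 (r q) * v2 (r q) * v3 (r q)).
Proof.
  intros H q Hq; destruct (cp_distinct _ _ _ _ _ H q Hq) as [d1 [d2 d3]].
  pose proof (cp_roots _ _ _ _ _ H q Hq) as R.
  apply (vieta _ _ _ _ _ _ d1 d2 d3); apply R; auto.
Qed.

(** The two conclusions are one identity with [v1] and [v2] exchanged, which Vieta's formulas permit
    by symmetry. [X] and [T] enter only through their values at [q]. *)
Lemma cp_closed D r v1 v2 v3 q X1 X2 T1 T2 : characteristic_param D r v1 v2 v3 -> D q ->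
  let dX f := pd1 f q * X2 - pd2 f q * X1 in
  let dT f := pd1 f q * T2 - pd2 f q * T1 in
  let y1 q := v1 (r q) in let y2 q := v2 (r q) in let y3 q := v3 (r q) in
  dX (comp_a r) + dT (comp_b r) = 0 -> dX (comp_b r) + dT (comp_c r) = 0 ->
  dX (comp_c r) + (2 * comp_b r q * dT (comp_b r) - comp_a r q * dT (comp_c r)
    - comp_c r q * dT (comp_a r)) = 0 ->
  (dX y2 - dX y3) + ((dT y2 - dT y3) * y1 q + (y2 q - y3 q) * dT y1) = 0 /\
  (dX y1 - dX y3) + ((dT y1 - dT y3) * y2 q + (y1 q - y3 q) * dT y2) = 0.
Proof.
  intros H Hq dX dT y1 y2 y3 r1 r2 r3.
  destruct (cp_distinct _ _ _ _ _ H q Hq) as [d1 [d2 d3]].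
  split.
  - apply (closed_at D (comp_a r) (comp_b r) (comp_c r) y1 y2 y3); auto; try apply H.
    apply (cp_vieta D r v1 v2 v3 H).
  - apply (closed_at D (comp_a r) (comp_b r) (comp_c r) y2 y1 y3); auto; try apply H.
    intros p Hp; destruct (cp_vieta D r v1 v2 v3 H p Hp) as [e1 [e2 e3]].
    unfold y1, y2, y3; rewrite e1, e2, e3; repeat split; field.
Qed.

Lemma same_curves_proportional (w w' : Defs.form1) (D : R * R -> Prop) (v : R * R -> R) :
  (forall q, D q -> snd (w q) = v q * fst (w q)) ->
  (forall q, D q -> snd (w' q) = v q * fst (w' q)) ->
  (forall q, D q -> fst (w q) <> 0) -> (forall q, D q -> fst (w' q) <> 0) ->
  same_curves D w w'.
Proof.
  intros h1 h2 n1 n2 q Hq [s t]; unfold eval_form; simpl.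
  rewrite (h1 q Hq), (h2 q Hq); split; intros e.
  - apply Rmult_eq_reg_l with (fst (w q)); [|auto].
    transitivity (fst (w' q) * (fst (w q) * s + v q * fst (w q) * t)); [ring|rewrite e; ring].
  - apply Rmult_eq_reg_l with (fst (w' q)); [|auto].
    transitivity (fst (w q) * (fst (w' q) * s + v q * fst (w' q) * t)); [ring|rewrite e; ring].
Qed.

(** This is [omega /\ (dx + v dt) = 0]: after substituting the system, the difference of the two
    sides is [- a_x] times the characteristic polynomial at [v]. *)
Lemma solution_eigenform D r v q : D q -> is_solution D r ->
  smooth2 D (comp_a r) -> smooth2 D (comp_b r) -> smooth2 D (comp_c r) ->
  v (r q) ^ 3 + comp_a r q * v (r q) ^ 2 - 2 * comp_b r q * v (r q) + comp_c r q = 0 ->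
  snd (pullback r (omega v) q) = v (r q) * fst (pullback r (omega v) q).
Proof.
  intros Hq S sa sb sc R; destruct (S q Hq) as [e1 [e2 e3]].
  rewrite (flux_pd1 D r q Hq sa sb sc) in e3.
  rewrite pullback_omega; simpl fst; simpl snd. rewrite e1, e2, e3.
  apply Rminus_diag_uniq.
  transitivity (- pd1 (comp_a r) q * (v (r q) ^ 3 + comp_a r q * v (r q) ^ 2 - 2 * comp_b r q * v (r q) + comp_c r q)); [ring|rewrite R; ring].
Qed.

Lemma lin_indep_l w w' q : lin_indep_at w w' q -> ~ (fst (w q) = 0 /\ snd (w q) = 0).
Proof.
  intros H [h1 h2]; destruct (H 1 0) as [z _]; [rewrite h1; ring|rewrite h2; ring|lra].
Qed.

Lemma lin_indep_r w w' q : lin_indep_at w w' q -> ~ (fst (w' q) = 0 /\ snd (w' q) = 0).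
Proof.
  intros H [h1 h2]; destruct (H 0 1) as [_ z]; [rewrite h1; ring|rewrite h2; ring|lra].
Qed.

Lemma solution_hexagonal D r v1 v2 v3 : characteristic_param D r v1 v2 v3 ->
  is_solution D r ->
  hexagonal_web D (pullback r (omega v1)) (pullback r (omega v2)) (pullback r (omega v3)).
Proof.
  intros H S.
  pose proof (cp_open _ _ _ _ _ H) as oD.
  pose proof (cp_a _ _ _ _ _ H) as sa. pose proof (cp_b _ _ _ _ _ H) as sb.
  pose proof (cp_c _ _ _ _ _ H) as sc.
  pose proof (cp_v1 _ _ _ _ _ H) as s1. pose proof (cp_v2 _ _ _ _ _ H) as s2.
  pose proof (cp_v3 _ _ _ _ _ H) as s3.
  set (y1 := fun q => v1 (r q)) in *. set (y2 := fun q => v2 (r q)) in *.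
  set (y3 := fun q => v3 (r q)) in *.
  assert (dist := cp_distinct _ _ _ _ _ H : forall q, D q -> y1 q <> y2 q /\ y2 q <> y3 q /\ y1 q <> y3 q).
  assert (ev : forall v q, D q -> v = v1 \/ v = v2 \/ v = v3 ->
    snd (pullback r (omega v) q) = v (r q) * fst (pullback r (omega v) q)).
  { intros v q Hq Hv; apply (solution_eigenform D); auto.
    apply (cp_roots _ _ _ _ _ H q Hq v Hv). }
  assert (nz : forall v q, D q -> v = v1 \/ v = v2 \/ v = v3 ->
    fst (pullback r (omega v) q) <> 0).
  (* If the [dx] coefficient vanished, so would the [dt] coefficient, and the whole form, against
     linear independence. *)
  { intros v q Hq Hv z. pose proof (ev v q Hq Hv) as e; rewrite z, Rmult_0_r in e.
    destruct Hv as [-> | [-> | ->]].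
    - apply (lin_indep_l _ _ _ (cp_indep12 _ _ _ _ _ H q Hq)); auto.
    - apply (lin_indep_r _ _ _ (cp_indep12 _ _ _ _ _ H q Hq)); auto.
    - apply (lin_indep_r _ _ _ (cp_indep13 _ _ _ _ _ H q Hq)); auto. }
  (* The normalized pair with [X = dx], [T = dt], and the zero connection form. *)
  exists (fun q => (y2 q - y3 q, (y2 q - y3 q) * y1 q)),
    (fun q => (y1 q - y3 q, (y1 q - y3 q) * y2 q)), (fun _ => (0, 0)).
  assert (ext0 : forall (k : R) q, pd1 (fun _ => k) q = 0 /\ pd2 (fun _ => k) q = 0).
  { intros k q; split; [exact (Derive_const k (fst q))|exact (Derive_const k (snd q))]. }
  split; [|split].
  - split; [|split; [|split; [|split]]].
    + split; intros n; simpl; repeat first [apply Ck2_minus|apply Ck2_mult]; auto.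
    + split; intros n; simpl; repeat first [apply Ck2_minus|apply Ck2_mult]; auto.
    + apply same_curves_proportional with (v := y1).
      * intros q Hq; simpl; ring.
      * intros q Hq; apply ev; auto.
      * intros q Hq; simpl; destruct (dist q Hq); lra.
      * intros q Hq; apply nz; auto.
    + apply same_curves_proportional with (v := y2).
      * intros q Hq; simpl; ring.
      * intros q Hq; apply ev; auto.
      * intros q Hq; simpl; destruct (dist q Hq); lra.
      * intros q Hq; apply nz; auto.
    + apply same_curves_proportional with (v := y3).
      * intros q Hq; simpl; ring.
      * intros q Hq; apply ev; auto.
      * intros q Hq; simpl; destruct (dist q Hq); lra.
      * intros q Hq; apply nz; auto.
  - split.
    + split; intros n; simpl; apply Ck2_const; auto.
    + intros q Hq; unfold ext_d, wedge; simpl.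
      destruct (S q Hq) as [e1 [e2 e3]].
      rewrite (flux_pd1 D r q Hq sa sb sc) in e3.
      (* The numbers [1 0 0 1] are the coefficients of [dx] and [dt]: then [dX f] is minus the
         [t]-derivative of [f], and [dT f] is its [x]-derivative. *)
      destruct (cp_closed D r v1 v2 v3 q 1 0 0 1 H Hq) as [c1 c2].
      * rewrite e1; ring.
      * rewrite e2; ring.
      * rewrite e3; ring.
      * assert (a1 := Ck2_is_pd1 0 D _ _ (s1 _) Hq). assert (a2 := Ck2_is_pd1 0 D _ _ (s2 _) Hq).
        assert (a3 := Ck2_is_pd1 0 D _ _ (s3 _) Hq).
        assert (b1 := Ck2_is_pd2 0 D _ _ (s1 _) Hq). assert (b2 := Ck2_is_pd2 0 D _ _ (s2 _) Hq).
        assert (b3 := Ck2_is_pd2 0 D _ _ (s3 _) Hq).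
        fold y1 y2 y3 in c1, c2.
        rewrite (is_pd1_unique _ _ _ (is_pd1_mult _ _ _ _ _ (is_pd1_minus _ _ _ _ _ a2 a3) a1)
          : pd1 (fun p => (y2 p - y3 p) * y1 p) q = _).
        rewrite (is_pd2_unique _ _ _ (is_pd2_minus _ _ _ _ _ b2 b3)
          : pd2 (fun p => y2 p - y3 p) q = _).
        rewrite (is_pd1_unique _ _ _ (is_pd1_mult _ _ _ _ _ (is_pd1_minus _ _ _ _ _ a1 a3) a2)
          : pd1 (fun p => (y1 p - y3 p) * y2 p) q = _).
        rewrite (is_pd2_unique _ _ _ (is_pd2_minus _ _ _ _ _ b1 b3)
          : pd2 (fun p => y1 p - y3 p) q = _).
        change (v1 (r q)) with (y1 q) in c1, c2; change (v2 (r q)) with (y2 q) in c1, c2.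
        change (v3 (r q)) with (y3 q) in c1, c2.
        split; (transitivity 0; [|ring]); [rewrite <- c1|rewrite <- c2]; ring.
  - intros q Hq; unfold ext_d; simpl.
    rewrite (proj1 (ext0 0 q)), (proj2 (ext0 0 q)); ring.
Qed.

(** * From a hexagonal web to a solution *)

Lemma cp_subset (D D' : R * R -> Prop) r v1 v2 v3 : open D' -> (forall q, D' q -> D q) ->
  characteristic_param D r v1 v2 v3 -> characteristic_param D' r v1 v2 v3.
Proof.
  intros oD' S [h1 h2 h3 h4 h5 h6 h7 h8 h9 h10 h11]; constructor; auto;
    intros n; apply Ck2_subset with D; auto.
Qed.

Lemma smooth_form_subset (D D' : R * R -> Prop) w : (forall q, D' q -> D q) ->
  smooth_form D w -> smooth_form D' w.
Proof. intros S [h1 h2]; split; intros n; apply Ck2_subset with D; auto. Qed.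

(** The vector [(snd w, - fst w)] lies in the kernel of [w], and evaluating [w'] on it gives the
    wedge product. *)
Lemma same_curves_wedge D w w' q : same_curves D w w' -> D q -> wedge w' w q = 0.
Proof.
  intros H Hq; destruct (H q Hq (snd (w q), - fst (w q))) as [h _].
  unfold eval_form in h; simpl in h. unfold wedge.
  rewrite <- h; [ring|ring].
Qed.

(** The common kernel of [phi1] and [phi2] is that of [w1] and [w2], hence trivial. Were the wedge
    zero, the kernel vector built from the coefficients of [phi1] would be common, so [phi1 = 0];
    likewise [phi2 = 0], and then every vector would be in the common kernel. *)
Lemma wedge_nonzero D w1 w2 phi1 phi2 q :
  same_curves D phi1 w1 -> same_curves D phi2 w2 -> D q ->
  lin_indep_at w1 w2 q -> wedge phi1 phi2 q <> 0.
Proof.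
  intros s1 s2 Hq ind z; unfold wedge in z.
  assert (K : forall K1 K2, eval_form phi1 q (K1, K2) = 0 -> eval_form phi2 q (K1, K2) = 0 ->
    K1 = 0 /\ K2 = 0).
  { intros K1 K2 h1 h2. apply s1 in h1; [|exact Hq]; apply s2 in h2; [|exact Hq].
    unfold eval_form in h1, h2; simpl in h1, h2.
    assert (d : wedge w1 w2 q <> 0).
    { intros d; unfold wedge in d.
      destruct (ind (- snd (w2 q)) (snd (w1 q))) as [z1 z2]; [lra|ring|].
      destruct (ind (- fst (w2 q)) (fst (w1 q))) as [z3 z4]; [ring|lra|].
      apply (lin_indep_l _ _ _ ind); split; lra. }
    split; apply Rmult_eq_reg_l with (wedge w1 w2 q); auto; unfold wedge.
    - transitivity (snd (w2 q) * (fst (w1 q) * K1 + snd (w1 q) * K2) -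
        snd (w1 q) * (fst (w2 q) * K1 + snd (w2 q) * K2)); [ring|rewrite h1, h2; ring].
    - transitivity (fst (w1 q) * (fst (w2 q) * K1 + snd (w2 q) * K2) -
        fst (w2 q) * (fst (w1 q) * K1 + snd (w1 q) * K2)); [ring|rewrite h1, h2; ring]. }
  destruct (K (- snd (phi1 q)) (fst (phi1 q))) as [k1 k2];
    [unfold eval_form; simpl; ring|unfold eval_form; simpl; lra|].
  assert (p1 : fst (phi1 q) = 0) by lra. assert (p2 : snd (phi1 q) = 0) by lra.
  destruct (K (- snd (phi2 q)) (fst (phi2 q))) as [k3 k4];
    [unfold eval_form; simpl; rewrite p1, p2; ring|unfold eval_form; simpl; ring|].
  destruct (K 1 0) as [k5 _]; [| |lra]; unfold eval_form; simpl; [rewrite p1, p2; ring|].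
  rewrite k4; ring.
Qed.

(** With [dg = phi], [d(exp (- g) phi1) = exp (- g) (d phi1 - phi /\ phi1)]. *)
Lemma rescaled_closed D (phi phi1 : Defs.form1) g q : open D -> D q ->
  smooth_form D phi1 -> is_pd1 g q (fst (phi q)) -> is_pd2 g q (snd (phi q)) ->
  ext_d phi1 q = wedge phi phi1 q ->
  ext_d (fun p => (exp (- g p) * fst (phi1 p), exp (- g p) * snd (phi1 p))) q = 0.
Proof.
  intros oD Hq [s1 s2] g1 g2 E; unfold ext_d, wedge in *; simpl.
  assert (a2 := Ck2_is_pd1 0 D _ _ (s2 _) Hq). assert (b1 := Ck2_is_pd2 0 D _ _ (s1 _) Hq).
  assert (x1 := is_pd1_comp1 (fun t => exp (- t)) g q (- exp (- g q)) _
    ltac:(auto_derive; [exact I|ring]) g1).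
  assert (x2 := is_pd2_comp1 (fun t => exp (- t)) g q (- exp (- g q)) _
    ltac:(auto_derive; [exact I|ring]) g2).
  rewrite (is_pd1_unique _ _ _ (is_pd1_mult _ _ _ _ _ x1 a2) :
    pd1 (fun p => exp (- g p) * snd (phi1 p)) q = _).
  rewrite (is_pd2_unique _ _ _ (is_pd2_mult _ _ _ _ _ x2 b1) :
    pd2 (fun p => exp (- g p) * fst (phi1 p)) q = _).
  match type of E with ?L = ?R' => transitivity (exp (- g q) * (L - R')); [ring|rewrite E; ring] end.
Qed.

(** The Leibniz rule for [d(al (X + y T))], sorted so that the terms differentiating [al] and [y]
    form the expression that [cp_closed] shows to vanish. *)
Lemma ext_d_combination D (al y : R * R -> R) (X T : Defs.form1) q : D q ->
  smooth2 D al -> smooth2 D y -> smooth_form D X -> smooth_form D T ->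
  let dX f := pd1 f q * snd (X q) - pd2 f q * fst (X q) in
  let dT f := pd1 f q * snd (T q) - pd2 f q * fst (T q) in
  ext_d (fun p => (al p * (fst (X p) + y p * fst (T p)), al p * (snd (X p) + y p * snd (T p)))) q =
  al q * (ext_d X q + y q * ext_d T q) + (dX al + (dT al * y q + al q * dT y)).
Proof.
  intros Hq sal sy [sX1 sX2] [sT1 sT2] dX dT; unfold ext_d, dX, dT; simpl.
  assert (l1 := Ck2_is_pd1 0 D _ _ (sal _) Hq). assert (l2 := Ck2_is_pd2 0 D _ _ (sal _) Hq).
  assert (y1 := Ck2_is_pd1 0 D _ _ (sy _) Hq). assert (y2 := Ck2_is_pd2 0 D _ _ (sy _) Hq).
  assert (x1 := Ck2_is_pd1 0 D _ _ (sX2 _) Hq). assert (x2 := Ck2_is_pd2 0 D _ _ (sX1 _) Hq).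
  assert (t1 := Ck2_is_pd1 0 D _ _ (sT2 _) Hq). assert (t2 := Ck2_is_pd2 0 D _ _ (sT1 _) Hq).
  rewrite (is_pd1_unique _ _ _ (is_pd1_mult _ _ _ _ _ l1 (is_pd1_plus _ _ _ _ _ x1
    (is_pd1_mult _ _ _ _ _ y1 t1))) :
    pd1 (fun p => al p * (snd (X p) + y p * snd (T p))) q = _).
  rewrite (is_pd2_unique _ _ _ (is_pd2_mult _ _ _ _ _ l2 (is_pd2_plus _ _ _ _ _ x2
    (is_pd2_mult _ _ _ _ _ y2 t2))) :
    pd2 (fun p => al p * (fst (X p) + y p * fst (T p))) q = _).
  ring.
Qed.

Lemma ext_d_ext (D : R * R -> Prop) (w w' : Defs.form1) (q : R * R) : open D -> D q ->
  (forall p, D p -> w p = w' p) -> ext_d w q = ext_d w' q.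
Proof.
  intros oD Hq h; unfold ext_d.
  rewrite (pd1_ext_open D (fun p : R * R => snd (w p)) (fun p : R * R => snd (w' p)) q oD Hq),
    (pd2_ext_open D (fun p : R * R => fst (w p)) (fun p : R * R => fst (w' p)) q oD Hq);
    [reflexivity| |]; intros p Hp; rewrite h; auto.
Qed.

(* Solve [(v2 - v3) (X + v1 T) = Phi1], [(v1 - v3) (X + v2 T) = Phi2] for [X], [T]. *)
Lemma hexagonal_closed_coframe D r v1 v2 v3 (Phi1 Phi2 : Defs.form1) :
  characteristic_param D r v1 v2 v3 ->
  smooth_form D Phi1 -> smooth_form D Phi2 ->
  (forall q, D q -> ext_d Phi1 q = 0 /\ ext_d Phi2 q = 0) ->
  (forall q, D q -> wedge Phi1 Phi2 q <> 0) ->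
  (forall q, D q -> wedge (pullback r (omega v1)) Phi1 q = 0 /\
     wedge (pullback r (omega v2)) Phi2 q = 0 /\
     wedge (pullback r (omega v3)) (form_sub Phi1 Phi2) q = 0) ->
  exists X T : Defs.form1, smooth_form D X /\ smooth_form D T /\
    forall q, D q -> ext_d X q = 0 /\ ext_d T q = 0 /\ wedge X T q <> 0 /\
    let dX f := pd1 f q * snd (X q) - pd2 f q * fst (X q) in
    let dT f := pd1 f q * snd (T q) - pd2 f q * fst (T q) in
    dX (comp_a r) + dT (comp_b r) = 0 /\ dX (comp_b r) + dT (comp_c r) = 0 /\
    dX (comp_c r) + (2 * comp_b r q * dT (comp_b r) - comp_a r q * dT (comp_c r)
      - comp_c r q * dT (comp_a r)) = 0.
Proof.
  intros H sP1 sP2 dP nP wP.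
  pose proof (cp_open _ _ _ _ _ H) as oD.
  pose proof (cp_v1 _ _ _ _ _ H) as s1. pose proof (cp_v2 _ _ _ _ _ H) as s2.
  pose proof (cp_v3 _ _ _ _ _ H) as s3.
  set (y1 := fun q => v1 (r q)) in *. set (y2 := fun q => v2 (r q)) in *.
  set (y3 := fun q => v3 (r q)) in *.
  assert (dist := cp_distinct _ _ _ _ _ H : forall q, D q -> y1 q <> y2 q /\ y2 q <> y3 q /\ y1 q <> y3 q).
  set (al := fun q => y2 q - y3 q). set (be := fun q => y1 q - y3 q).
  (* Dividing by [al] and [be] leaves [X + y1 T] and [X + y2 T], whose difference is [(y1 - y2) T];
     this is applied to each coefficient separately. *)
  set (solT := fun (q : R * R) p1 p2 => (p1 / al q - p2 / be q) / (y1 q - y2 q)).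
  set (solX := fun (q : R * R) p1 p2 => p1 / al q - y1 q * solT q p1 p2).
  set (T := fun q => (solT q (fst (Phi1 q)) (fst (Phi2 q)), solT q (snd (Phi1 q)) (snd (Phi2 q))) : R * R).
  set (X := fun q => (solX q (fst (Phi1 q)) (fst (Phi2 q)), solX q (snd (Phi1 q)) (snd (Phi2 q))) : R * R).
  assert (n1 : forall q, D q -> al q <> 0) by (intros q Hq; destruct (dist q Hq); unfold al; lra).
  assert (n2 : forall q, D q -> be q <> 0) by (intros q Hq; destruct (dist q Hq); unfold be; lra).
  assert (n3 : forall q, D q -> y1 q - y2 q <> 0) by (intros q Hq; destruct (dist q Hq); lra).
  assert (sal : smooth2 D al) by (intros n; apply Ck2_minus; auto).
  assert (sbe : smooth2 D be) by (intros n; apply Ck2_minus; auto).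
  assert (sT : forall p1 p2, smooth2 D p1 -> smooth2 D p2 -> smooth2 D (fun q => solT q (p1 q) (p2 q))).
  { intros p1 p2 h1 h2 n; unfold solT.
    repeat first [apply Ck2_div | apply Ck2_minus]; auto; try apply s1; try apply s2. }
  assert (sX : forall p1 p2, smooth2 D p1 -> smooth2 D p2 -> smooth2 D (fun q => solX q (p1 q) (p2 q))).
  { intros p1 p2 h1 h2 n; unfold solX; apply Ck2_minus; auto.
    - apply Ck2_div; auto.
    - apply Ck2_mult; auto. apply sT; auto. }
  assert (fT : smooth_form D T) by (split; apply sT; first [apply sP1|apply sP2]).
  assert (fX : smooth_form D X) by (split; apply sX; first [apply sP1|apply sP2]).
  assert (E1 : forall q, D q -> Phi1 q =
    (al q * (fst (X q) + y1 q * fst (T q)), al q * (snd (X q) + y1 q * snd (T q)))).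
  { intros q Hq; rewrite (surjective_pairing (Phi1 q)) at 1; unfold X, T, solX; simpl.
    f_equal; field; auto. }
  assert (E2 : forall q, D q -> Phi2 q =
    (be q * (fst (X q) + y2 q * fst (T q)), be q * (snd (X q) + y2 q * snd (T q)))).
  { intros q Hq; rewrite (surjective_pairing (Phi2 q)) at 1; unfold X, T, solX, solT; simpl.
    f_equal; field; repeat split; auto. }
  exists X, T; split; [exact fX|split; [exact fT|]].
  intros q Hq.
  assert (sys : let dX f := pd1 f q * snd (X q) - pd2 f q * fst (X q) in
    let dT f := pd1 f q * snd (T q) - pd2 f q * fst (T q) in
    dX (comp_a r) + dT (comp_b r) = 0 /\ dX (comp_b r) + dT (comp_c r) = 0 /\
    dX (comp_c r) + (2 * comp_b r q * dT (comp_b r) - comp_a r q * dT (comp_c r)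
      - comp_c r q * dT (comp_a r)) = 0).
  { intros dX dT. destruct (dist q Hq) as [d1 [d2 d3]].
    destruct (wP q Hq) as [w1 [w2 w3]].
    apply (eigenforms_system (comp_a r q) (comp_b r q) (comp_c r q) (y1 q) (y2 q) (y3 q)); auto.
    intros v Hv. unfold dX, dT.
    destruct Hv as [-> | [-> | ->]]; (split; [apply (cp_roots _ _ _ _ _ H q Hq); auto|]).
    - apply Rmult_eq_reg_l with (al q); [|auto]. rewrite Rmult_0_r, <- w1.
      unfold wedge; rewrite pullback_omega, (E1 q Hq); simpl fst; simpl snd; fold (y1 q); ring.
    - apply Rmult_eq_reg_l with (be q); [|auto]. rewrite Rmult_0_r, <- w2.
      unfold wedge; rewrite pullback_omega, (E2 q Hq); simpl fst; simpl snd; fold (y2 q); ring.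
    - apply Rmult_eq_reg_l with (y2 q - y1 q); [|lra]. rewrite Rmult_0_r, <- w3.
      unfold wedge, form_sub; rewrite pullback_omega, (E1 q Hq), (E2 q Hq); simpl fst; simpl snd.
      unfold al, be; fold (y3 q); ring. }
  destruct (cp_closed D r v1 v2 v3 q _ _ _ _ H Hq (proj1 sys) (proj1 (proj2 sys)) (proj2 (proj2 sys)))
    as [c1 c2].
  assert (k1 := ext_d_combination D al y1 X T q Hq sal s1 fX fT).
  assert (k2 := ext_d_combination D be y2 X T q Hq sbe s2 fX fT).
  rewrite <- (ext_d_ext D _ _ q oD Hq E1), (proj1 (dP q Hq)) in k1.
  rewrite <- (ext_d_ext D _ _ q oD Hq E2), (proj2 (dP q Hq)) in k2.
  assert (j1 := is_pd1_unique _ _ _ (is_pd1_minus _ _ _ _ _ (Ck2_is_pd1 0 D _ _ (s2 _) Hq) (Ck2_is_pd1 0 D _ _ (s3 _) Hq)) : pd1 al q = _).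
  assert (j2 := is_pd2_unique _ _ _ (is_pd2_minus _ _ _ _ _ (Ck2_is_pd2 0 D _ _ (s2 _) Hq) (Ck2_is_pd2 0 D _ _ (s3 _) Hq)) : pd2 al q = _).
  assert (j3 := is_pd1_unique _ _ _ (is_pd1_minus _ _ _ _ _ (Ck2_is_pd1 0 D _ _ (s1 _) Hq) (Ck2_is_pd1 0 D _ _ (s3 _) Hq)) : pd1 be q = _).
  assert (j4 := is_pd2_unique _ _ _ (is_pd2_minus _ _ _ _ _ (Ck2_is_pd2 0 D _ _ (s1 _) Hq) (Ck2_is_pd2 0 D _ _ (s3 _) Hq)) : pd2 be q = _).
  cbv beta zeta in k1, k2, c1, c2.
  rewrite j1, j2 in k1; rewrite j3, j4 in k2.
  fold y1 y2 y3 in c1, c2.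
  change (v1 (r q)) with (y1 q) in c1, c2; change (v2 (r q)) with (y2 q) in c1, c2.
  change (v3 (r q)) with (y3 q) in c1, c2.
  (* With the derivative terms gone, [dX + y1 dT = 0], and below [dX + y2 dT = 0]; distinct
     velocities make both [dX] and [dT] vanish. *)
  assert (z1 : al q * (ext_d X q + y1 q * ext_d T q) = 0).
  { rewrite <- (Rminus_0_r (al q * _)), <- c1 at 1. unfold al in *; lra. }
  assert (z2 : be q * (ext_d X q + y2 q * ext_d T q) = 0).
  { rewrite <- (Rminus_0_r (be q * _)), <- c2 at 1. unfold be in *; lra. }
  apply Rmult_integral in z1, z2.
  destruct z1 as [z1|z1]; [destruct (n1 q Hq z1)|]. destruct z2 as [z2|z2]; [destruct (n2 q Hq z2)|].
  assert (zT : ext_d T q = 0).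
  { apply Rmult_eq_reg_l with (y1 q - y2 q); [lra|auto]. }
  split; [rewrite zT in z1; lra|split; [exact zT|split; [|exact sys]]].
  intros z; apply (nP q Hq); unfold wedge; rewrite (E1 q Hq), (E2 q Hq); simpl.
  transitivity (al q * be q * (y2 q - y1 q) * wedge X T q); [unfold wedge, X, T; simpl; ring|].
  rewrite z; ring.
Qed.

Lemma hexagonal_solution M D r v1 v2 v3 q0 : characteristic_param D r v1 v2 v3 ->
  local_param M D r -> D q0 ->
  hexagonal_web D (pullback r (omega v1)) (pullback r (omega v2)) (pullback r (omega v3)) ->
  exists E r', local_param M E r' /\ (exists e, E e /\ r' e = r q0) /\ is_solution E r'.
Proof.
  intros H lp Hq0 [phi1 [phi2 [phi [[sp1 [sp2 [c1 [c2 c3]]]] [[sp dp] cl]]]]].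
  pose proof (cp_open _ _ _ _ _ H) as oD.
  (* Closed forms need primitives, so the chart is cut down to a square around [q0]. *)
  destruct (oD q0 Hq0) as [e He]. set (B := ball q0 e) in *.
  assert (oB : open B) by apply open_ball_pair.
  assert (B0 : B q0) by apply ball_center.
  destruct (poincare q0 e phi) as [g [sg dg]].
  { apply smooth_form_subset with D; auto. }
  { intros q Hq; auto. }
  fold B in sg, dg.
  assert (HB := cp_subset D B r v1 v2 v3 oB He H).
  set (Phi := fun (f : Defs.form1) (p : R * R) => (exp (- g p) * fst (f p), exp (- g p) * snd (f p))).
  assert (sPhi : forall f, smooth_form D f -> smooth_form B (Phi f)).
  { intros f [f1 f2]; split; intros n; simpl; (apply Ck2_mult; [exact oB| |]).
    - apply Ck2_exp; [exact oB|apply Ck2_opp; [exact oB|apply sg]].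
    - apply Ck2_subset with D; [exact He|apply f1].
    - apply Ck2_exp; [exact oB|apply Ck2_opp; [exact oB|apply sg]].
    - apply Ck2_subset with D; [exact He|apply f2]. }
  assert (wPhi : forall q w f, wedge w f q = 0 -> wedge w (Phi f) q = 0).
  { intros q w f h; unfold wedge in *; simpl.
    match type of h with ?L = _ => transitivity (exp (- g q) * L); [ring|rewrite h; ring] end. }
  destruct (hexagonal_closed_coframe B r v1 v2 v3 (Phi phi1) (Phi phi2)) as [X [T [sX [sT hXT]]]].
  - exact HB.
  - apply sPhi, sp1.
  - apply sPhi, sp2.
  - intros q Hq; destruct (dg q Hq) as [g1 g2]; destruct (dp q (He q Hq)) as [p1 p2].
    split; apply (rescaled_closed D phi); auto.
  - intros q Hq z.
    apply (wedge_nonzero D _ _ _ _ q c1 c2 (He q Hq) (cp_indep12 _ _ _ _ _ HB q Hq)).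
    unfold wedge in *; simpl in z. pose proof (exp_pos (- g q)) as ep.
    apply Rmult_eq_reg_l with (exp (- g q) * exp (- g q)); [|nra].
    rewrite Rmult_0_r, <- z; ring.
  - intros q Hq; split; [|split].
    + apply wPhi, (same_curves_wedge D); auto.
    + apply wPhi, (same_curves_wedge D); auto.
    + assert (h := same_curves_wedge D _ _ q c3 (He q Hq)).
      apply wPhi in h; rewrite <- h; unfold wedge, form_sub, Phi; simpl; ring.
  - destruct (poincare q0 e X sX) as [x [sx dx]]; [intros q Hq; apply hXT; exact Hq|].
    destruct (poincare q0 e T sT) as [t [st dt]]; [intros q Hq; apply hXT; exact Hq|].
    fold B in sx, dx, st, dt.
    set (F := fun q : R * R => (x q, t q)).
    assert (Fd : forall q, B q -> pd1 (fun p => fst (F p)) q = fst (X q) /\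
      pd2 (fun p => fst (F p)) q = snd (X q) /\ pd1 (fun p => snd (F p)) q = fst (T q) /\
      pd2 (fun p => snd (F p)) q = snd (T q)).
    { intros q Hq; destruct (dx q Hq) as [x1 x2], (dt q Hq) as [t1 t2].
      split; [|split; [|split]].
      - exact (is_pd1_unique _ _ _ x1).
      - exact (is_pd2_unique _ _ _ x2).
      - exact (is_pd1_unique _ _ _ t1).
      - exact (is_pd2_unique _ _ _ t2). }
    destruct (local_inverse B F q0 oB B0 sx st) as [D' [E [G [D0 [DB d]]]]].
    (* As [dx = X] and [dt = T], the Jacobian of [(x, t)] is the coefficient of [X /\ T]. *)
    { unfold jac; destruct (Fd q0 B0) as [-> [-> [-> ->]]]. apply (hXT q0 B0). }
    exists E, (fun e => r (G e)).
    assert (lp' := local_param_reparam M D r D' E F G lp (fun q h => He q (DB q h)) d).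
    split; [exact lp'|split].
    + exists (F q0); split; [apply d, D0|]. rewrite (diffeo_GF _ _ _ _ d q0 D0); reflexivity.
    + intros s Hs.
      assert (oE := diffeo_open_cod _ _ _ _ d).
      set (q := G s). assert (Hq : D' q) by (apply d, Hs).
      assert (HqB := DB q Hq). assert (HqD := He q HqB).
      assert (G1 := diffeo_G1 _ _ _ _ d). assert (G2 := diffeo_G2 _ _ _ _ d).
      assert (i1 := Ck2_is_pd1 0 E _ _ (G1 _) Hs). assert (i2 := Ck2_is_pd2 0 E _ _ (G1 _) Hs).
      assert (k1 := Ck2_is_pd1 0 E _ _ (G2 _) Hs). assert (k2 := Ck2_is_pd2 0 E _ _ (G2 _) Hs).
      destruct (diffeo_jacobian _ _ _ _ q d Hq) as [m1 [m2 [m3 m4]]].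
      destruct (Fd q HqB) as [f1 [f2 [f3 f4]]].
      rewrite f1, f2 in m1, m2; rewrite f3, f4 in m3, m4.
      unfold q in m1, m2, m3, m4; rewrite (diffeo_FG _ _ _ _ d s Hs) in m1, m2, m3, m4; fold q in m1, m2, m3, m4.
      destruct (hXT q HqB) as [_ [_ [_ [r1 [r2 r3]]]]].
      assert (sa := cp_a _ _ _ _ _ H). assert (sb := cp_b _ _ _ _ _ H). assert (sc := cp_c _ _ _ _ _ H).
      assert (ch1 : forall f, smooth2 D f -> pd1 (fun p => f (G p)) s =
        pd1 f q * pd1 (fun p => fst (G p)) s + pd2 f q * pd1 (fun p => snd (G p)) s).
      { intros f sf; apply is_pd1_unique, (is_pd1_comp D); auto. }
      assert (ch2 : forall f, smooth2 D f -> pd2 (fun p => f (G p)) s =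
        pd1 f q * pd2 (fun p => fst (G p)) s + pd2 f q * pd2 (fun p => snd (G p)) s).
      { intros f sf; apply is_pd2_unique, (is_pd2_comp D); auto. }
      destruct lp' as [_ [[sa' [sb' sc']] _]].
      rewrite (flux_pd1 E (fun e => r (G e)) s Hs sa' sb' sc').
      rewrite (ch1 _ sa : pd1 (comp_a (fun e => r (G e))) s = _),
        (ch1 _ sb : pd1 (comp_b (fun e => r (G e))) s = _),
        (ch1 _ sc : pd1 (comp_c (fun e => r (G e))) s = _),
        (ch2 _ sa : pd2 (comp_a (fun e => r (G e))) s = _),
        (ch2 _ sb : pd2 (comp_b (fun e => r (G e))) s = _),
        (ch2 _ sc : pd2 (comp_c (fun e => r (G e))) s = _).
      split; [|split].
      * apply (inverse_jacobian_transport _ _ _ _ _ _ _ _ _ _ _ _ m1 m2 m3 m4 r1).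
      * apply (inverse_jacobian_transport _ _ _ _ _ _ _ _ _ _ _ _ m1 m2 m3 m4 r2).
      * change (comp_a (fun e => r (G e)) s) with (comp_a r q).
        change (comp_b (fun e => r (G e)) s) with (comp_b r q).
        change (comp_c (fun e => r (G e)) s) with (comp_c r q).
        (* The third equation has [f = c] and [h = b^2 - a c]; the partial derivatives of this flux
           are passed in expanded form. *)
        etransitivity; [apply (inverse_jacobian_transport _ _ _ _ _ _ _ _ _ _
          (2 * comp_b r q * pd1 (comp_b r) q - comp_a r q * pd1 (comp_c r) q - comp_c r q * pd1 (comp_a r) q)
          (2 * comp_b r q * pd2 (comp_b r) q - comp_a r q * pd2 (comp_c r) q - comp_c r q * pd2 (comp_a r) q)
          m1 m2 m3 m4)|ring].
        rewrite <- r3; ring.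
Qed.

Theorem mainTheorem3
  (U : R * R * R -> Prop) (v1 v2 v3 : R * R * R -> R) (M : R * R * R -> Prop)
  (hU : open U)
  (hcont : forall u, U u ->
     continuous v1 u /\ continuous v2 u /\ continuous v3 u)
  (hroots : forall u, U u ->
     char_poly u (v1 u) = 0 /\ char_poly u (v2 u) = 0 /\ char_poly u (v3 u) = 0)
  (hdistinct : forall u, U u -> v1 u <> v2 u /\ v2 u <> v3 u /\ v1 u <> v3 u)
  (hM : smooth_surface M)
  (hMU : forall u, M u -> U u)
  (hind12 : restrictions_indep M (omega v1) (omega v2))
  (hind23 : restrictions_indep M (omega v2) (omega v3))
  (hind13 : restrictions_indep M (omega v1) (omega v3)) :
  hydrodynamic_surface M <-> hexagonal_on M (omega v1) (omega v2) (omega v3).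
Proof.
  assert (CP : forall D r, local_param M D r -> characteristic_param D r v1 v2 v3).
  { intros D r lp.
    assert (UD : forall q, D q -> U (r q)) by (intros q Hq; apply hMU, (local_param_image M D r q lp Hq)).
    destruct (lp) as [oD [[sa [sb sc]] _]]; constructor; auto.
    - apply (velocity_smooth U v1 v2 v3 M D r); auto.
      intros u Hu; destruct (hcont u Hu) as [h1 [h2 h3]]; exact h1.
    (* [velocity_smooth] treats the velocity listed first, so the roots are permuted. *)
    - apply (velocity_smooth U v2 v1 v3 M D r); auto.
      + intros u Hu; destruct (hcont u Hu) as [h1 [h2 h3]]; exact h2.
      + intros u Hu; destruct (hroots u Hu) as [h1 [h2 h3]]; auto.
      + intros u Hu; destruct (hdistinct u Hu) as [h1 [h2 h3]]; auto.
    - apply (velocity_smooth U v3 v1 v2 M D r); auto.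
      + intros u Hu; destruct (hcont u Hu) as [h1 [h2 h3]]; exact h3.
      + intros u Hu; destruct (hroots u Hu) as [h1 [h2 h3]]; auto.
      + intros u Hu; destruct (hdistinct u Hu) as [h1 [h2 h3]]; auto.
    - intros q Hq v Hv; rewrite <- char_poly_comp.
      destruct (hroots _ (UD q Hq)) as [h1 [h2 h3]].
      destruct Hv as [-> | [-> | ->]]; assumption.
    - exact (hind12 D r lp).
    - exact (hind13 D r lp). }
  (* Both properties are local. A chart in which the system holds serves unchanged for the web;
     conversely, the chart of the web is traded for one whose coordinates are the primitives [x] and
     [t]. *)
  split.
  - intros hyd u Mu; destruct (hyd u Mu) as [D [r [lp [Hu S]]]].
    exists D, r; split; [exact lp|split; [exact Hu|]].
    apply solution_hexagonal; auto.
  - intros hex u Mu; destruct (hex u Mu) as [D [r [lp [[q [Hq <-]] W]]]].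
    apply (hexagonal_solution M D r v1 v2 v3 q); auto.
Qed.
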